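(* Let $n\ge 1$ and $d\ge 2$ be integers, let $R=\mathbb{C}[x_0,\dots,x_n]$ (standard graded), let $g_0,\dots,g_n\in R_{d-1}$, and let $I\subseteq R$ be the ideal generated by the $2\times 2$ minors $x_ig_j-x_jg_i$ ($0\le i<j\le n$) of the matrix $$M=\begin{pmatrix} x_0 & x_1 & \dots & x_n\\ g_0 & g_1 & \dots & g_n\end{pmatrix}.$$ Let $V(I)\subseteq\mathbb{P}^n$ be the zero locus of $I$. If $\dim V(I)=0$, then $I$ is saturated and the minimal graded free resolution $$0\to F_n\to\cdots\to F_1\to I\to 0$$ of $I$ as a graded $R$-module satisfies, for every $1\le i\le n$, $$F_i\cong\bigoplus_{j=1}^{i} R\bigl(-j(d-2)-i-1\bigr)^{\binom{n+1}{i+1}}.$$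
   Context: $R(a)$ denotes the graded free $R$-module of rank one with degrees shifted by $a$, i.e. $R(a)_k=R_{a+k}$. *)

(* Defs.v *)
From HB Require Import structures.
From mathcomp Require Import all_boot all_order all_algebra.
From mathcomp Require Import Rstruct.
From mathcomp Require Import complex.
From mathcomp Require Import mpoly.
From Stdlib Require Import Reals.
Set Implicit Arguments. Unset Strict Implicit. Unset Printing Implicit Defensive.
Import GRing.Theory.
Local Open Scope ring_scope.

Definition CC : numClosedFieldType := (Rdefinitions.R)[i].

Definition Pol (n : nat) := {mpoly CC[n.+1]}.

(* p is homogeneous of degree k (k an integer; for k < 0 this forces p = 0,
   and 0 is homogeneous of every degree). *)
Definition homogeneous (n : nat) (k : int) (p : Pol n) : Prop :=
  forall m : 'X_{1..n.+1}, p@_m != 0 -> (mdeg m)%:Z = k.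

Definition minor (n : nat) (g : 'I_n.+1 -> Pol n) (i j : 'I_n.+1) : Pol n :=
  'X_i * g j - 'X_j * g i.

Definition in_I (n : nat) (g : 'I_n.+1 -> Pol n) (p : Pol n) : Prop :=
  exists c : 'I_n.+1 -> 'I_n.+1 -> Pol n,
    p = \sum_(i < n.+1) \sum_(j < n.+1 | ltn i j) c i j * minor g i j.

(* I is saturated: I = (I : m^oo) with m = (x_0, ..., x_n);
   f in (I : m^k) iff every monomial of degree k times f lies in I. *)
Definition saturated_I (n : nat) (g : 'I_n.+1 -> Pol n) : Prop :=
  forall f : Pol n,
    (exists k : nat, forall m : 'X_{1..n.+1}, mdeg m = k -> in_I g ('X_[m] * f)) ->
    in_I g f.

Definition in_VI (n : nat) (g : 'I_n.+1 -> Pol n) (x : 'I_n.+1 -> CC) : Prop :=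
  (exists i, x i != 0) /\ forall p : Pol n, in_I g p -> p.@[x] = 0.

(* dim V(I) = 0 : V(I) is a nonempty finite set of points of P^n. *)
Definition zero_dim_VI (n : nat) (g : 'I_n.+1 -> Pol n) : Prop :=
  (exists x, in_VI g x) /\
  exists s : seq ('I_n.+1 -> CC),
    forall x, in_VI g x ->
      exists y c, List.In y s /\ forall i, x i = c * y i.

(* A graded free resolution ... -> F_3 -> F_2 -> F_1 -> I -> 0 of I.
   rk i = rank of F_{i+1}; dg i k = degree of the k-th basis element of F_{i+1}
   (so F_{i+1} = (+)_k R(- dg i k));
   phi1 : F_1 -> R (the images of the basis of F_1, landing in I);
   mp i : F_{i+2} -> F_{i+1}, acting on row vectors by v |-> v *m mp i. *)
Record gres (n : nat) := GRes {
  rk : nat -> nat;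
  dg : forall i, 'I_(rk i) -> int;
  phi1 : 'M[Pol n]_(rk 0, 1);
  mp : forall i, 'M[Pol n]_(rk i.+1, rk i)
}.
Arguments rk {n} g i.
Arguments dg {n} g i k.
Arguments phi1 {n} g.
Arguments mp {n} g i.

Definition is_graded_free_res (n : nat) (g : 'I_n.+1 -> Pol n) (F : gres n) : Prop :=
  (forall k, homogeneous (dg F 0 k) (phi1 F k 0)) /\
  (forall i k l, homogeneous (dg F i.+1 k - dg F i l) (mp F i k l)) /\
  (forall p, in_I g p <-> exists v : 'rV[Pol n]_(rk F 0), p = (v *m phi1 F) 0 0) /\
  (forall v : 'rV[Pol n]_(rk F 0),
      v *m phi1 F = 0 <-> exists w : 'rV[Pol n]_(rk F 1), v = w *m mp F 0) /\
  (forall i (v : 'rV[Pol n]_(rk F i.+1)),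
      v *m mp F i = 0 <-> exists w : 'rV[Pol n]_(rk F i.+2), v = w *m mp F i.+1).

(* Minimality: d(F_{i+1}) is contained in m F_i for i >= 2, i.e. every entry of
   every differential F_{i+2} -> F_{i+1} has zero constant term. *)
Definition is_minimal_res (n : nat) (F : gres n) : Prop :=
  forall i k l, (mp F i k l)@_0%MM = 0.

Definition is_min_graded_free_res (n : nat) (g : 'I_n.+1 -> Pol n) (F : gres n) : Prop :=
  is_graded_free_res g F /\ is_minimal_res F.

Definition expected_shifts (n d i : nat) : seq int :=
  flatten [seq nseq 'C(n.+1, i.+1) (Posz (addn (addn (muln j (subn d 2)) i) 1)) | j <- iota 1 i].

Definition has_expected_shape (n d : nat) (F : gres n) : Prop :=
  (forall i : nat, leq 1 i && leq i n ->
     perm_eq [seq dg F i.-1 k | k <- enum 'I_(rk F i.-1)] (expected_shifts n d i)) /\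
  (forall i : nat, ltn n i -> rk F i.-1 = 0%N).
Arguments has_expected_shape : clear implicits.

(* Main.v *)
Require Import Defs.
From Stdlib Require Import Reals Lra ClassicalEpsilon.
From HB Require Import structures.
From mathcomp Require Import all_boot all_order all_algebra fingroup perm.
From mathcomp Require Import Rstruct complex mpoly.
From mathcomp Require Import zify ring.
Set Implicit Arguments. Unset Strict Implicit. Unset Printing Implicit Defensive.
Import Order.TTheory GRing.Theory Num.Theory.
Local Open Scope ring_scope.

(** The resolution is the Eagon-Northcott complex, whose i-th module is
    Lambda^(i+1) (x) D_(i-1)(R^2), with differential built from the Koszul
    contractions by x and by g. Each minor acts on it by a null-homotopic map, so
    every element of I kills its homology modulo any ideal. Since V(I) is finite,
    a generic linear form l does not vanish on it, and by the Nullstellensatz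
    x_i^N lies in I + (l) for N large. Modulo l, the powers x_1^N, ..., x_n^N are
    a regular sequence of length n, the length of the complex, and agree with
    elements of I; hence the complex is exact modulo l. Graded Nakayama makes it
    exact, and exactness modulo l also shows that l is a nonzerodivisor modulo I,
    so I is saturated. The shape of any other minimal resolution follows by
    comparing it with this one: the constant parts of the comparison maps are
    mutually inverse matrices which respect degrees. *)

(** * Exterior algebra *)

(** Exactness is reached by elements alone, with congruences in place of quotient rings. As dim V(I)
    = 0, the ideal I has codimension n, exactly the length of the complex, so a regular sequence of
    length n inside I would suffice; but none is explicit in R. Cutting by a hyperplane that misses
    V(I) replaces it by pure powers of the n remaining variables, whose regularity is a statement
    about exponents of monomials. The price is that exactness has to be pulled back through the
    partial quotients by x_1^N, ..., x_j^N, which is why null-homotopy is needed modulo arbitrary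
    ideals. The Nullstellensatz rests on the uncountability of the complex numbers and a count of
    dimensions. Minimality comes from the entries of the differentials, combinations of the x_j and
    g_j, all of positive degree when d >= 2. *)

Section ExteriorAlgebra.
Variables (R : comNzRingType) (N : nat).
Local Notation V := {ffun {set 'I_N} -> R^o}.
Implicit Types (v : V) (i j : 'I_N) (T : {set 'I_N}).

(** The sign of moving e_i to its place in the increasing product e_T: one factor -1 for each
    element of T below i. *)
Definition pos_sign i T : R := \prod_(j in T) (-1) ^+ (j < i)%N.

Lemma pos_signU1 i j T : j \notin T ->
  pos_sign i (j |: T) = (-1) ^+ (j < i)%N * pos_sign i T.
Proof. by move=> jT; rewrite /pos_sign big_setU1. Qed.

Lemma pos_signD1 i j T : j \in T ->
  pos_sign i T = (-1) ^+ (j < i)%N * pos_sign i (T :\ j).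
Proof. by move=> jT; rewrite /pos_sign (big_setD1 j). Qed.

Lemma pos_sign_sqr i T : pos_sign i T * pos_sign i T = 1.
Proof.
rewrite /pos_sign -big_split big1 //= => j _.
by rewrite -expr2 sqrr_sign.
Qed.

(** An element of [V] lists its coefficients on the basis e_T. Here e_i multiplies from the left;
    [contract] pairs with the dual vector of e_i. *)
Definition wedge i v : V :=
  [ffun T : {set 'I_N} => if i \in T then pos_sign i T * v (T :\ i) else 0].
Definition contract i v : V :=
  [ffun T : {set 'I_N} => if i \in T then 0 else pos_sign i T * v (i |: T)].

Lemma wedge_is_linear i : linear (wedge i).
Proof.
move=> a u v; apply/ffunP => T; rewrite !ffunE /=.
case: ifP => _; last by rewrite scaler0 addr0.
by rewrite /GRing.scale /=; ring.
Qed.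
HB.instance Definition _ i := GRing.isLinear.Build R V V _ (wedge i) (wedge_is_linear i).

Lemma contract_is_linear i : linear (contract i).
Proof.
move=> a u v; apply/ffunP => T; rewrite !ffunE /=.
case: ifP => _; first by rewrite scaler0 addr0.
by rewrite /GRing.scale /=; ring.
Qed.
HB.instance Definition _ i :=
  GRing.isLinear.Build R V V _ (contract i) (contract_is_linear i).

Lemma sign_ltn_anti i j : i != j -> (-1) ^+ (j < i)%N * (-1) ^+ (i < j)%N = -1 :> R.
Proof.
rewrite neq_ltn => /orP[] h; rewrite h ltnNge (ltnW h) /= expr0 expr1.
  by rewrite mul1r.
by rewrite mulr1.
Qed.

Lemma contractK i v : contract i (contract i v) = 0.
Proof.
apply/ffunP => T; rewrite !ffunE setU11.
by case: ifP => //; rewrite mulr0.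
Qed.

Lemma contractC i j v : contract i (contract j v) = - contract j (contract i v).
Proof.
have [->|ij] := eqVneq i j; first by rewrite contractK oppr0.
apply/ffunP => T; rewrite !ffunE !inE (eq_sym j i) (negPf ij) /=.
case: (boolP (i \in T)) => iT.
  by case: ifP; rewrite ?mulr0 ?oppr0.
case: (boolP (j \in T)) => jT; first by rewrite mulr0 oppr0.
rewrite !pos_signU1 // setUCA.
have := sign_ltn_anti ij; set a := (-1) ^+ _; set b := (-1) ^+ _ => ab.
have a2 : a * a = 1 by rewrite -expr2 sqrr_sign.
have ->: b = - a by rewrite -[b]mul1r -a2 -mulrA ab mulrN1.
ring.
Qed.

(** The Clifford relation: contraction is an antiderivation for the wedge product. *)
Lemma contract_wedge i j v :
  contract i (wedge j v) = (i == j)%:R *: v - wedge j (contract i v).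
Proof.
apply/ffunP => T; rewrite !ffunE !inE.
have [->|ij] := eqVneq i j.
  rewrite scale1r /=; case: (boolP (j \in T)) => jT.
    rewrite (pos_signD1 _ jT) ltnn mul1r mulrA pos_sign_sqr mul1r setD1K //.
    by rewrite subrr.
  by rewrite subr0 pos_signU1 // ltnn mul1r mulrA pos_sign_sqr mul1r setU1K.
rewrite scale0r /= sub0r.
case: (boolP (i \in T)) => iT.
  by case: (j \in T); rewrite ?mulr0 oppr0.
case: (boolP (j \in T)) => jT; last by rewrite mulr0 oppr0.
rewrite pos_signU1 // (pos_signD1 i jT).
have ->: (i |: T) :\ j = i |: (T :\ j).
  apply/setP => k; rewrite !inE; case: (eqVneq k i) => [->|//].
  by rewrite (negPf ij).
have := sign_ltn_anti ij; set a := (-1) ^+ _; set b := (-1) ^+ _ => ab.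
have a2 : a * a = 1 by rewrite -expr2 sqrr_sign.
have ->: b = - a by rewrite -[b]mul1r -a2 -mulrA ab mulrN1.
rewrite -[RHS]mul1r -a2; ring.
Qed.

(** The grading is a support condition on the whole exterior algebra, so that maps between different
    powers need no dependent types; 0 has every degree. *)
Definition of_degree k v := forall T, v T != 0 -> #|T| = k.

Lemma of_degreeN k v : of_degree k v -> of_degree k (- v).
Proof. by move=> h T; rewrite ffunE oppr_eq0; apply: h. Qed.

Lemma of_degreeD k u v : of_degree k u -> of_degree k v -> of_degree k (u + v).
Proof.
move=> hu hv T; rewrite ffunE; have [u0|/hu -> //] := eqVneq (u T) 0.
by rewrite u0 add0r => /hv.
Qed.

Lemma of_degreeZ k a v : of_degree k v -> of_degree k (a *: v).
Proof.
move=> h T; rewrite ffunE => avT; apply: h; apply: contraNneq avT => ->.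
by rewrite scaler0.
Qed.

Lemma of_degree0 k : of_degree k 0.
Proof. by move=> T; rewrite ffunE eqxx. Qed.

Lemma of_degree_sum k (I : finType) (F : I -> V) :
  (forall s, of_degree k (F s)) -> of_degree k (\sum_s F s).
Proof.
move=> h; elim/big_rec: _ => [|i v _ hv]; first exact: of_degree0.
exact: of_degreeD.
Qed.

Lemma of_degree_wedge k i v : of_degree k v -> of_degree k.+1 (wedge i v).
Proof.
move=> h T; rewrite ffunE; case: ifP => [iT|_]; last by rewrite eqxx.
move=> ne; rewrite (cardsD1 i) iT add1n (h (T :\ i)) //.
by apply: contraNneq ne => ->; rewrite mulr0.
Qed.

Lemma of_degree_contract k i v : of_degree k.+1 v -> of_degree k (contract i v).
Proof.
move=> h T; rewrite ffunE; case: ifP => [_|iT]; first by rewrite eqxx.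
move=> ne; apply: succn_inj; rewrite -(h (i |: T)) ?cardsU1 ?iT //.
by apply: contraNneq ne => ->; rewrite mulr0.
Qed.

Definition koszul (x : 'I_N -> R) v : V := \sum_i x i *: contract i v.

Lemma koszul_is_linear x : linear (koszul x).
Proof.
move=> a u v; rewrite /koszul scaler_sumr -big_split /=; apply: eq_bigr => i _.
by rewrite linearP scalerDr !scalerA mulrC.
Qed.
HB.instance Definition _ x :=
  GRing.isLinear.Build R V V _ (koszul x) (koszul_is_linear x).

Lemma of_degree_koszul k x v : of_degree k.+1 v -> of_degree k (koszul x v).
Proof.
move=> h; apply: of_degree_sum => i; apply: of_degreeZ.
exact: of_degree_contract.
Qed.

Lemma koszulE x v T :
  koszul x v T = \sum_(i | i \notin T) x i * pos_sign i T * v (i |: T).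
Proof.
rewrite /koszul sum_ffunE [RHS]big_mkcond; apply: eq_bigr => i _.
rewrite !ffunE; case: ifP => _ /=; first by rewrite scaler0.
by rewrite /GRing.scale /= mulrA.
Qed.

Lemma koszul_wedge x i v :
  koszul x (wedge i v) = x i *: v - wedge i (koszul x v).
Proof.
rewrite /koszul linear_sum -sumrN.
under eq_bigr => j _ do rewrite contract_wedge scalerBr.
rewrite big_split /= (bigD1 i) //= eqxx scale1r big1 ?addr0.
  by congr (_ + _); apply: eq_bigr => j _; rewrite [wedge _ (_ *: _)]linearZ.
by move=> j /negPf ->; rewrite scale0r scaler0.
Qed.

Lemma koszulC x y v : koszul x (koszul y v) = - koszul y (koszul x v).
Proof.
rewrite /koszul.
under eq_bigr => i _ do rewrite linear_sum scaler_sumr.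
rewrite exchange_big -sumrN; apply: eq_bigr => j _ /=.
rewrite linear_sum scaler_sumr -sumrN; apply: eq_bigr => i _ /=.
by rewrite !linearZ /= !scalerA contractC mulrC scalerN.
Qed.

(* Not a consequence of [koszulC], since 2 may be a zero divisor. *)
Lemma koszulK x v : koszul x (koszul x v) = 0.
Proof.
apply/ffunP => T; rewrite [RHS]ffunE.
rewrite /koszul; under eq_bigr => i _ do rewrite linear_sum scaler_sumr /=.
pose f i j := x i *: contract i (x j *: contract j v).
have fE i j : f i j = - f j i.
  by rewrite /f !linearZ /= !scalerA contractC scalerN mulrC.
have fii i : f i i = 0 by rewrite /f linearZ /= contractK !scaler0.
rewrite (_ : \sum_i _ = \sum_(p : 'I_N * 'I_N) f p.1 p.2); last first.
  by rewrite -(pair_bigA _ f).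
(* The diagonal terms vanish, and swapping the indices cancels the terms on its two sides. *)
rewrite (bigID (fun p : 'I_N * 'I_N => p.1 < p.2)%N) /=.
rewrite [X in _ + X](bigID (fun p : 'I_N * 'I_N => p.2 < p.1)%N) /=.
rewrite [X in _ + (_ + X)]big1 ?addr0; last first.
  case=> i j /=; rewrite -!leqNgt => /andP[h1 h2].
  have /val_inj -> : i = j :> nat by apply/eqP; rewrite eqn_leq h1 h2.
  exact: fii.
rewrite [X in _ + X](eq_bigl (fun p : 'I_N * 'I_N => p.2 < p.1)%N); last first.
  case=> i j /=; rewrite andbC; case: ltnP => // h.
  by rewrite ltnNge ltnW.
rewrite [X in _ + X](reindex (fun p : 'I_N * 'I_N => (p.2, p.1))) /=; last first.
  by exists (fun p : 'I_N * 'I_N => (p.2, p.1)) => -[].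
rewrite -big_split big1 ?ffunE //= => p _.
by rewrite fE addNr.
Qed.

End ExteriorAlgebra.

(** * The Eagon-Northcott complex *)

(** Ideals are predicates on elements: exactness modulo an ideal is then a congruence between rows
    over R. *)
Definition is_ideal (R : comNzRingType) (J : R -> Prop) : Prop :=
  [/\ J 0, forall a b, J a -> J b -> J (a + b) & forall a b, J b -> J (a * b)].

Section Ideals.
Variables (R : comNzRingType) (J : R -> Prop).
Hypothesis idJ : is_ideal J.

Lemma ideal0 : J 0. Proof. by case: idJ. Qed.
Lemma idealD a b : J a -> J b -> J (a + b). Proof. by case: idJ => _ + _; apply. Qed.
Lemma idealMl a b : J b -> J (a * b). Proof. by case: idJ => _ _; apply. Qed.
Lemma idealMr a b : J a -> J (a * b). Proof. by rewrite mulrC; apply: idealMl. Qed.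
Lemma idealN a : J a -> J (- a). Proof. by rewrite -mulN1r; apply: idealMl. Qed.
Lemma idealB a b : J a -> J b -> J (a - b).
Proof. by move=> Ja Jb; apply: idealD (idealN Jb). Qed.
Lemma ideal_sum (I : Type) (r : seq I) (P : pred I) (F : I -> R) :
  (forall i, P i -> J (F i)) -> J (\sum_(i <- r | P i) F i).
Proof. move=> h; elim/big_rec: _ => [|i a Pi Ja]; [exact: ideal0|exact: idealD (h i Pi) Ja]. Qed.

Definition adjoin (l p : R) : Prop := exists u, J (p - u * l).

Lemma adjoin_sub l p : J p -> adjoin l p.
Proof. by exists 0; rewrite mul0r subr0. Qed.

Lemma adjoin_self l : adjoin l l.
Proof. by exists 1; rewrite mul1r subrr; apply: ideal0. Qed.

Lemma adjoin_ideal l : is_ideal (adjoin l).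
Proof.
split; first exact/adjoin_sub/ideal0.
  move=> p q [u hu] [v hv]; exists (u + v).
  by have := idealD hu hv; rewrite mulrDl opprD addrACA.
move=> p q [u hu]; exists (p * u).
by have := idealMl p hu; rewrite mulrBr mulrA.
Qed.

Definition row_in n (v : 'rV[R]_n) : Prop := forall k, J (v 0 k).

Lemma row_in0 n : row_in (0 : 'rV[R]_n).
Proof. by move=> k; rewrite mxE; apply: ideal0. Qed.
Lemma row_inD n (u v : 'rV[R]_n) : row_in u -> row_in v -> row_in (u + v).
Proof. by move=> hu hv k; rewrite mxE; apply: idealD. Qed.
Lemma row_inN n (v : 'rV[R]_n) : row_in v -> row_in (- v).
Proof. by move=> hv k; rewrite mxE; apply: idealN. Qed.
Lemma row_inB n (u v : 'rV[R]_n) : row_in u -> row_in v -> row_in (u - v).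
Proof. by move=> hu hv; apply: row_inD (row_inN hv). Qed.
Lemma row_inZ n a (v : 'rV[R]_n) : row_in v -> row_in (a *: v).
Proof. by move=> hv k; rewrite mxE; apply: idealMl. Qed.
Lemma row_inZl n a (v : 'rV[R]_n) : J a -> row_in (a *: v).
Proof. by move=> Ja k; rewrite mxE; apply: idealMr. Qed.
Lemma row_inM n p (v : 'rV[R]_n) (A : 'M[R]_(n, p)) : row_in v -> row_in (v *m A).
Proof. by move=> hv k; rewrite mxE; apply: ideal_sum => i _; apply: idealMr. Qed.

End Ideals.

Section EagonNorthcott.
Variables (R : comNzRingType) (N : nat) (x g : 'I_N -> R).
Local Notation V := {ffun {set 'I_N} -> R^o}.
Implicit Types (c : nat -> V) (p q : 'I_N).

(* A chain in Lambda^(i+2) (x) D_i(R^2), the (i+1)-st module of the complex, is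
   encoded by its components c 0, ..., c i in Lambda^(i+2), one for each monomial
   of degree i in two variables; the values c b with b > i are junk. *)
Definition en_diff c : nat -> V := fun b => koszul x (c b) + koszul g (c b.+1).
(** Contracting Lambda^2 by both rows of the matrix lands in Lambda^0, whose only coefficient sits
    at [set0]. *)
Definition en_aug c : R := koszul g (koszul x (c 0%N)) set0.

Lemma en_diffK c b : en_diff (en_diff c) b = 0.
Proof.
rewrite /en_diff !linearD /= !koszulK add0r addr0 koszulC.
by rewrite addNr.
Qed.

Lemma en_aug_diff c : en_aug (en_diff c) = 0.
Proof.
rewrite /en_aug /en_diff !linearD /= koszulK linear0 add0r koszulC koszulK.
by rewrite linear0 oppr0 ffunE.
Qed.

Definition en_minor p q : R := x p * g q - x q * g p.

(* With h = g_q e_p - g_p e_q, contraction by x anticommutes with h up to the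
   minor x_p g_q - x_q g_p, and contraction by g anticommutes with h. So h is a
   homotopy except in the top component, where a chain has no component i+1 for g
   to contract; the last clause corrects this defect. *)
Definition en_homotopy i p q c : nat -> V := fun b =>
  if (b <= i)%N then g q *: wedge p (c b) - g p *: wedge q (c b)
  else - wedge p (wedge q (koszul x (c i))).

Lemma koszul_x_homotopy p q (v : V) :
  koszul x (g q *: wedge p v - g p *: wedge q v) =
  en_minor p q *: v -
    (g q *: wedge p (koszul x v) - g p *: wedge q (koszul x v)).
Proof.
rewrite linearB !linearZ /= !koszul_wedge !scalerN !scalerBr !scalerA.
rewrite /en_minor scalerBl (mulrC (x p)) (mulrC (x q)).
by rewrite !opprD !opprK addrACA.
Qed.

Lemma koszul_g_homotopy p q (v : V) :
  koszul g (g q *: wedge p v - g p *: wedge q v) =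
  - (g q *: wedge p (koszul g v) - g p *: wedge q (koszul g v)).
Proof.
rewrite linearB !linearZ /= !koszul_wedge !scalerN !scalerBr !scalerA (mulrC (g q)).
by rewrite !opprD !opprK addrACA subrr add0r.
Qed.

Lemma koszul_g_wedge2 p q (v : V) :
  koszul g (wedge p (wedge q v)) =
  g p *: wedge q v - g q *: wedge p v + wedge p (wedge q (koszul g v)).
Proof.
by rewrite !koszul_wedge linearB /= [wedge p (_ *: _)]linearZ opprD opprK addrA.
Qed.

(** The homotopy identity at the foot of the complex: the homotopy from R to Lambda^2 is
    multiplication by e_p wedge e_q, and it is applied to the augmentation. *)
Lemma en_diff_homotopy0 p q c :
  en_diff (en_homotopy 0 p q c) 0%N =
  en_minor p q *: c 0%N - wedge p (wedge q (koszul g (koszul x (c 0%N)))).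
Proof.
rewrite /en_diff /en_homotopy /= koszul_x_homotopy linearN /= koszul_g_wedge2.
rewrite !opprD !opprK -addrA; congr (_ + _).
by rewrite !addrA addrK addNr add0r.
Qed.

Lemma en_diff_homotopyS i p q c b : (b <= i.+1)%N ->
  en_diff (en_homotopy i.+1 p q c) b =
  en_minor p q *: c b - en_homotopy i p q (en_diff c) b.
Proof.
rewrite /en_diff /en_homotopy => bi; rewrite bi koszul_x_homotopy.
rewrite -addrA; congr (_ + _); rewrite ltnS.
(* At b = i+1 both sides use the correction clause. There [koszul x] kills the x-part of
   [en_diff c i] and leaves the mixed contraction of c (i+1). *)
have [ib|ib] := leqP b i; last first.
  have {bi ib} -> : b = i.+1 by apply/eqP; rewrite eqn_leq bi ib.
  rewrite linearN /= koszul_g_wedge2.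
  rewrite [koszul x (_ + _)]linearD /= koszulK add0r (koszulC x g).
  rewrite [wedge q (- _)]linearN [wedge p (- _)]linearN /= !opprD !opprK.
  by rewrite !addrA addrK addNr add0r.
rewrite koszul_g_homotopy -opprD; congr (- _).
by rewrite [wedge p (_ + _)]linearD [wedge q (_ + _)]linearD /= !scalerDr opprD addrACA.
Qed.

(** * Bases, row vectors and matrices of the complex *)

Definition en_basis i : {set {set 'I_N} * 'I_i.+1} :=
  [set s : {set 'I_N} * 'I_i.+1 | #|s.1| == i.+2].

(** A label (S, b) stands for e_S times the monomial in which b is the exponent lowered by
    contraction with g. *)
Definition en_label i (k : 'I_#|en_basis i|) : {set 'I_N} * 'I_i.+1 := enum_val k.

Lemma card_en_label i (k : 'I_#|en_basis i|) : #|(en_label k).1| = i.+2.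
Proof. by have := enum_valP k; rewrite inE => /eqP. Qed.

Lemma en_label_le i (k : 'I_#|en_basis i|) : ((en_label k).2 <= i)%N.
Proof. by rewrite -ltnS ltn_ord. Qed.

Definition chain_of i (v : 'rV[R]_#|en_basis i|) : nat -> V := fun b =>
  [ffun S : {set 'I_N} =>
    \sum_k v 0 k * (((en_label k).1 == S) && ((en_label k).2 == b :> nat))%:R].

Definition row_of i c : 'rV[R]_#|en_basis i| :=
  \row_k c (en_label k).2 (en_label k).1.

Lemma of_degree_chain_of i (v : 'rV_#|en_basis i|) b :
  of_degree i.+2 (chain_of v b).
Proof.
move=> S; rewrite ffunE; case: (eqVneq #|S| i.+2) => // Si.
rewrite big1 ?eqxx // => k _; case: eqP => [kS|_]; last by rewrite mulr0.
by case/eqP: Si; rewrite -kS card_en_label.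
Qed.

Lemma chain_ofK i : cancel (@chain_of i) (@row_of i).
Proof.
move=> v; apply/rowP => k; rewrite !mxE ffunE (bigD1 k) //= !eqxx mulr1.
rewrite big1 ?addr0 // => l lk.
case: andP => [[/eqP h1 /eqP h2]|_]; last by rewrite mulr0.
case/eqP: lk; apply: enum_val_inj.
by move: h1 h2; rewrite /en_label; case: (enum_val l) (enum_val k) => [? ?] [? ?] /= -> /val_inj ->.
Qed.

Lemma row_ofK i c b : (b <= i)%N -> of_degree i.+2 (c b) ->
  chain_of (row_of i c) b = c b.
Proof.
move=> bi hc; apply/ffunP => S; rewrite ffunE.
have [Si|Si] := eqVneq #|S| i.+2; last first.
  rewrite big1; last first.
    move=> k _; case: eqP => [kS|_]; last by rewrite mulr0.
    by case/eqP: Si; rewrite -kS card_en_label.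
  by apply/esym/eqP; apply: contraTT isT => /hc /eqP; rewrite (negPf Si).
have Sb : (S, inord b : 'I_i.+1) \in en_basis i by rewrite inE /= Si.
rewrite (bigD1 (enum_rank_in Sb (S, inord b))) //= !mxE /en_label enum_rankK_in //=.
rewrite inordK // !eqxx mulr1 big1 ?addr0 // => k /negP kS.
case: andP => [[/eqP h1 /eqP h2]|_]; last by rewrite mulr0.
case: kS; apply/eqP; apply: enum_val_inj; rewrite enum_rankK_in //.
case: (enum_val k) h1 h2 => [S' b'] /= -> h2.
by congr pair; apply: val_inj; rewrite /= inordK.
Qed.

Lemma chain_of_linear i b : linear (fun v : 'rV[R]_#|en_basis i| => chain_of v b).
Proof.
move=> a u v; apply/ffunP => S; rewrite !ffunE.
rewrite scaler_sumr -big_split /=; apply: eq_bigr => k _.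
by rewrite !mxE /GRing.scale /=; ring.
Qed.

Definition en_map i (v : 'rV[R]_#|en_basis i.+1|) : 'rV[R]_#|en_basis i| :=
  row_of i (en_diff (chain_of v)).

Lemma en_map_is_linear i : linear (@en_map i).
Proof.
move=> a u v; apply/rowP => k; rewrite !mxE /en_diff !chain_of_linear.
by rewrite !linearP /= !ffunE /GRing.scale /=; ring.
Qed.
HB.instance Definition _ i :=
  GRing.isLinear.Build R _ _ _ (@en_map i) (@en_map_is_linear i).

Definition en_aug_map (v : 'rV[R]_#|en_basis 0|) : 'rV[R]_1 :=
  \row_(k < 1) en_aug (chain_of v).

Lemma en_aug_map_is_linear : linear en_aug_map.
Proof.
move=> a u v; apply/rowP => k; rewrite !mxE /en_aug chain_of_linear.
by rewrite !linearP /= !ffunE.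
Qed.
HB.instance Definition _ :=
  GRing.isLinear.Build R _ _ _ en_aug_map en_aug_map_is_linear.

(** Index 0 is R itself, so the augmentation is the differential [en_mx 0] and exactness reads the
    same at every positive index. *)
Definition en_rank i : nat := if i is i'.+1 then #|en_basis i'| else 1.

Definition en_mx i : 'M[R]_(en_rank i.+1, en_rank i) :=
  if i is i'.+1 then lin1_mx (@en_map i') else lin1_mx en_aug_map.

Lemma mul_en_mx0 (v : 'rV[R]_(en_rank 1)) :
  v *m en_mx 0 = \row_(k < 1) en_aug (chain_of v).
Proof. by rewrite mul_rV_lin1. Qed.

Lemma mul_en_mxS i (v : 'rV[R]_(en_rank i.+2)) :
  v *m en_mx i.+1 = row_of i (en_diff (chain_of v)).
Proof. by rewrite mul_rV_lin1. Qed.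

Lemma en_diff_degree i c b : of_degree i.+1 (c b) -> of_degree i.+1 (c b.+1) ->
  of_degree i (en_diff c b).
Proof. by move=> h1 h2; apply: of_degreeD; apply: of_degree_koszul. Qed.

Lemma en_homotopy_degree i p q c b : (forall b', (b' <= i)%N -> of_degree i.+2 (c b')) ->
  of_degree i.+3 (en_homotopy i p q c b).
Proof.
move=> h; rewrite /en_homotopy; case: ifP => bi.
  by apply: of_degreeD; [|apply: of_degreeN]; apply: of_degreeZ;
    apply: of_degree_wedge; apply: h.
apply: of_degreeN; do 2!apply: of_degree_wedge; apply: of_degree_koszul.
exact: h.
Qed.

Lemma mul_en_mx_en_mx i (v : 'rV[R]_(en_rank i.+2)) :
  v *m en_mx i.+1 *m en_mx i = 0.
Proof.
rewrite mul_en_mxS; case: i v => [|i] v.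
  rewrite mul_en_mx0; apply/rowP => k; rewrite !mxE /en_aug row_ofK //; first exact: en_aug_diff.
  by apply: en_diff_degree; apply: of_degree_chain_of.
rewrite mul_en_mxS; apply/rowP => k; rewrite !mxE.
have hk := en_label_le k.
rewrite {1}/en_diff !row_ofK ?(leqW hk) //;
  do ?[by apply: en_diff_degree; apply: of_degree_chain_of].
by rewrite -/(en_diff _ _) en_diffK ffunE.
Qed.

(** From minor * v = d h v + h d v: the last term has coefficients in J as soon as d v does, because
    h is linear over R. *)
Lemma en_null_homotopic p q i (J : R -> Prop) (v : 'rV[R]_(en_rank i.+1)) :
  is_ideal J -> row_in J (v *m en_mx i) ->
  exists w, row_in J (en_minor p q *: v - w *m en_mx i.+1).
Proof.
move=> idJ Jdv.
have Jwedge r (u : V) : (forall S, J (u S)) -> forall S, J (wedge r u S).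
  move=> hu S; rewrite ffunE; case: ifP => _; last exact: ideal0.
  exact: idealMl.
pose c := chain_of (v : 'rV_#|en_basis i|).
have hc b : of_degree i.+2 (c b) by apply: of_degree_chain_of.
exists (row_of i.+1 (en_homotopy i p q c)) => k; rewrite mul_en_mxS.
have hk := @en_label_le i k.
have -> : (en_minor p q *: v -
    row_of i (en_diff (chain_of (row_of i.+1 (en_homotopy i p q c))))) 0 k =
    (en_minor p q *: c (en_label k).2 -
     en_diff (en_homotopy i p q c) (en_label k).2) (en_label k).1.
  rewrite -{1}[v]chain_ofK !mxE {1}/en_diff !row_ofK ?(leqW hk) //;
    do ?exact: en_homotopy_degree.
  by rewrite !ffunE.
move: (en_label k).1 (en_label k).2 hk => S b /= {k}.
case: i v @c hc Jdv b => [|i] v c hc Jdv b hb.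
  have {hb} -> : b = 0%N :> nat by case: b hb => [[]].
  rewrite en_diff_homotopy0 subKr; do 2![apply: (Jwedge) => {}S].
  (* Two contractions of Lambda^2 leave degree 0, so only the coefficient at [set0], the
     augmentation, can be nonzero. *)
  have [S0|S0] := eqVneq S set0.
    by have := Jdv 0; rewrite mul_en_mx0 mxE /en_aug S0.
  suff -> : koszul g (koszul x (c 0%N)) S = 0 by apply: ideal0.
  have h0 : of_degree 0 (koszul g (koszul x (c 0%N))).
    by do 2!apply: of_degree_koszul.
  by apply/eqP; apply: contraNT S0 => /h0/eqP; rewrite cards_eq0.
rewrite en_diff_homotopyS // subKr.
have Jd b' S' : (b' <= i)%N -> J (en_diff c b' S').
  move=> hb'; have <- : chain_of (row_of i (en_diff c)) b' = en_diff c b'.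
    by apply: row_ofK => //; apply: en_diff_degree.
  by rewrite ffunE -mul_en_mxS; apply: ideal_sum => // k _; apply: idealMr.
rewrite /en_homotopy; case: ifP => bi.
  have JZ a r : J ((a *: wedge r (en_diff c b)) S).
    by rewrite ffunE; apply: idealMl => //; apply: (Jwedge) => ?; apply: Jd.
  by rewrite ffunE; apply: idealD => //; rewrite ffunE; apply: idealN.
rewrite ffunE; apply: idealN => //; do 2![apply: (Jwedge) => ?].
by rewrite koszulE; apply: ideal_sum => // ? _; apply: idealMl => //; apply: Jd.
Qed.

Lemma en_aug_wedge2 p q :
  en_aug (fun=> wedge p (wedge q [ffun T : {set 'I_N} => (T == set0)%:R])) =
  en_minor p q.
Proof.
rewrite /en_aug.
set one : V := [ffun _ => _].
have k0 y : koszul y one = 0.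
  apply/ffunP => T; rewrite koszulE big1 ?ffunE // => i _.
  have /negPf e : i |: T != set0 by apply/set0Pn; exists i; rewrite setU11.
  by rewrite ffunE e mulr0.
rewrite !koszul_wedge k0 linear0 subr0 linearB !linearZ /=.
rewrite !koszul_wedge k0 !linear0 ?subr0 ?addr0 scalerN !scalerA.
by rewrite !ffunE eqxx /GRing.scale /= !mulr1 /en_minor.
Qed.

Lemma en_minor_mem_image p q : exists v, v *m en_mx 0 = \row_(k < 1) en_minor p q.
Proof.
exists (row_of 0 (fun=> wedge p (wedge q [ffun T : {set 'I_N} => (T == set0)%:R]))).
rewrite mul_en_mx0; apply/rowP => k; rewrite !mxE -en_aug_wedge2 /en_aug.
rewrite row_ofK //; do 2!apply: of_degree_wedge.
by move=> T; rewrite ffunE; case: (T =P set0) => [->|_]; rewrite ?cards0 ?eqxx.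
Qed.

(** The double contraction of c 0 is antisymmetric in p and q, so the sum over all pairs folds onto
    p < q and produces the minors. *)
Lemma en_aug_minors c :
  en_aug c = \sum_(p < N) \sum_(q < N | (p < q)%N)
    contract q (contract p (c 0%N)) set0 * en_minor p q.
Proof.
rewrite /en_aug /koszul.
pose f p q : R := contract q (contract p (c 0%N)) set0.
have fC p q : f p q = - f q p by rewrite /f contractC ffunE.
have f0 p : f p p = 0 by rewrite /f contractK ffunE.
rewrite sum_ffunE.
under eq_bigr => q _ do rewrite linear_sum scaler_sumr sum_ffunE /=.
rewrite exchange_big /=.
have -> : \sum_(p < N) \sum_(q < N) (g q *: contract q (x p *: contract p (c 0%N))) set0
  = \sum_(p < N) \sum_(q < N) x p * g q * f p q.
  apply: eq_bigr => p _; apply: eq_bigr => q _; rewrite linearZ /= scalerA.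
  by rewrite ffunE /GRing.scale /= mulrC [RHS]mulrC (mulrC (g q)).
pose G p q := x p * g q * f p q.
transitivity (\sum_(p < N) \sum_(q < N | (p < q)%N) (G p q + G q p)); last first.
  apply: eq_bigr => p _; apply: eq_bigr => q _; rewrite /G (fC q p) -/(f p q).
  by rewrite /en_minor; ring.
under [RHS]eq_bigr => p _ do rewrite big_split /=.
rewrite big_split /= [X in _ = _ + X](exchange_big_dep predT) //= -big_split /=.
apply: eq_bigr => p _; rewrite (bigID (fun q : 'I_N => (p < q)%N)) /=; congr (_ + _).
rewrite (bigD1 p) ?ltnn //= -/(G p p) {1}/G f0 mulr0 add0r; apply: eq_bigl => q.
by rewrite -leqNgt ltn_neqAle andbC.
Qed.

End EagonNorthcott.

(** * Exactness modulo a regular sequence *)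

Section AcyclicModRegularSequence.
Variables (R : comNzRingType) (r : nat -> nat) (d : forall i, 'M[R]_(r i.+1, r i)).
Variables (n : nat) (J : nat -> R -> Prop) (y : nat -> R).
Hypothesis dd0 : forall i (v : 'rV_(r i.+2)), v *m d i.+1 *m d i = 0.
Hypothesis r_eq0 : forall i, (n <= i)%N -> r i.+1 = 0%N.
Hypothesis idealJ : forall j, is_ideal (J j).
Hypothesis J_succ : forall j a, J j.+1 a <-> exists q, J j (a - y j * q).
Hypothesis y_regular : forall j a, (j < n)%N -> J j (y j * a) -> J j a.
(** In the application y_j is a power of a variable, which only agrees modulo l with an element p of
    I; it is p that carries the homotopy. *)
Hypothesis y_null : forall j, (j < n)%N -> exists2 p, J 0 (p - y j) &
  forall i (v : 'rV_(r i.+1)), row_in (J j) (v *m d i) ->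
    exists w, row_in (J j) (p *: v - w *m d i.+1).

Lemma regular_ideal_mono j a : J 0 a -> J j a.
Proof.
elim: j => // j IHj Ja; apply/J_succ; exists 0.
by rewrite mulr0 subr0; apply: IHj.
Qed.

(* Descending induction on j: modulo the first j elements of the regular
   sequence, the complex is exact in degrees > j. If v is a cycle modulo J_j,
   then y_j v = w d modulo J_j, so w is a cycle modulo J_{j+1}, hence
   w = u d + y_j t modulo J_j, and y_j can be cancelled in y_j v = y_j t d. *)
Lemma acyclic_mod_regular i (v : 'rV_(r i.+1)) :
  row_in (J 0) (v *m d i) -> exists u, row_in (J 0) (v - u *m d i.+1).
Proof.
suff E k j : (j + k = n)%N -> forall i, (j <= i)%N -> forall v : 'rV_(r i.+1),
    row_in (J j) (v *m d i) -> exists u, row_in (J j) (v - u *m d i.+1).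
  exact: (E n 0%N).
elim: k j => [|k IHk] j; rewrite ?addn0.
  move=> -> {i}i ni {}v _; exists 0 => l.
  by have := ltn_ord l; rewrite {2}r_eq0.
move=> jk {}i ji {}v dv.
have jn : (j < n)%N by rewrite -jk -addSnnS leq_addr.
have [p pE null] := y_null jn.
have [w hw] := null _ _ dv.
have Jp : J j.+1 p by apply/J_succ; exists 1; rewrite mulr1; apply: regular_ideal_mono.
have incl a : J j a -> J j.+1 a by move=> Ja; apply/J_succ; exists 0; rewrite mulr0 subr0.
have wd : row_in (J j.+1) (w *m d i.+1).
  have -> : w *m d i.+1 = p *: v - (p *: v - w *m d i.+1) by rewrite subKr.
  by apply: row_inB => //; [apply: row_inZl|move=> l; apply: incl].
have [u hu] := IHk j.+1 (etrans (addSnnS _ _) jk) i.+1 ji w wd.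
have /fin_all_exists[t ht] l : exists q, J j ((w - u *m d i.+2) 0 l - y j * q).
  exact/J_succ.
pose tv := \row_l t l.
exists tv => l; apply: y_regular => //.
have tE : row_in (J j) (w - u *m d i.+2 - y j *: tv).
  by move=> m; move: (ht m); rewrite !mxE.
have -> : y j * (v - tv *m d i.+1) 0 l =
    (p *: v - w *m d i.+1) 0 l + ((w - u *m d i.+2 - y j *: tv) *m d i.+1) 0 l
    - (p - y j) * v 0 l.
  rewrite !mulmxBl dd0 subr0 -scalemxAl !mxE; ring.
apply: idealB => //; first apply: idealD => //.
  by apply: row_inM.
by apply: idealMr => //; apply: regular_ideal_mono.
Qed.

End AcyclicModRegularSequence.

(** * Graded matrices and Nakayama's lemma *)

Section Grading.
Variables (K : idomainType) (n : nat).
Local Notation pol := {mpoly K[n]}.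
Implicit Types (p q f : pol) (k e : int) (P Q : pred int) (m : 'X_{1..n}).

(** Over the complex numbers this is convertible to [homogeneous]. *)
Definition homogen k p : Prop := forall m, p@_m != 0 -> (mdeg m)%:Z = k.

(** The degrees to keep are given by a predicate, which serves both for single components and for
    truncation at degree at most e. *)
Definition hproj P p : pol :=
  \sum_(m <- msupp p) (if P (mdeg m)%:Z then p@_m else 0) *: 'X_[m].

Lemma mcoeff_hproj P p m :
  (hproj P p)@_m = if P (mdeg m)%:Z then p@_m else 0.
Proof.
rewrite /hproj raddf_sum /=.
under eq_bigr => m' _ do rewrite mcoeffZ mcoeffX.
have [mp|mp] := boolP (m \in msupp p).
  rewrite (bigD1_seq m) ?msupp_uniq //= eqxx mulr1 big1 ?addr0 // => m' /negPf ->.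
  by rewrite mulr0.
rewrite big_seq big1; first by rewrite memN_msupp_eq0 // if_same.
move=> m' m'p; case: eqP => [m'm|_]; last by rewrite mulr0.
by rewrite m'm (negPf mp) in m'p.
Qed.

Lemma hprojD P p q : hproj P (p + q) = hproj P p + hproj P q.
Proof.
apply/mpolyP => m; rewrite mcoeffD !mcoeff_hproj mcoeffD.
by case: ifP; rewrite ?addr0.
Qed.

Lemma hproj0 P : hproj P 0 = 0.
Proof. by apply/mpolyP => m; rewrite mcoeff_hproj mcoeff0 if_same. Qed.

Lemma hproj1 P : hproj P 1 = (P 0)%:R.
Proof.
apply/mpolyP => m; rewrite mcoeff_hproj mcoeff1; have [->|/negPf m0] := eqVneq m 0%MM.
  by rewrite mdeg0; case: (P 0); rewrite ?mcoeff1 ?mcoeff0 ?eqxx.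
by rewrite if_same; case: (P 0); rewrite ?mcoeff1 ?mcoeff0 ?m0.
Qed.

Lemma hproj_sum P (I : Type) (r : seq I) (Q : pred I) (F : I -> pol) :
  hproj P (\sum_(i <- r | Q i) F i) = \sum_(i <- r | Q i) hproj P (F i).
Proof. by apply: (big_morph _ (hprojD P) (hproj0 P)). Qed.

Lemma eq_hproj P Q p : P =1 Q -> hproj P p = hproj Q p.
Proof. by move=> PQ; apply/mpolyP => m; rewrite !mcoeff_hproj PQ. Qed.

Lemma hprojM P e f q : homogen e f ->
  hproj P (f * q) = f * hproj (fun j => P (j + e)) q.
Proof.
move=> hf; apply/mpolyP => m; rewrite mcoeff_hproj !mcoeffM.
rewrite -[LHS](_ : \sum_(k : 'X_{1..n < (mdeg m).+1, (mdeg m).+1} |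
    m == (k.1 + k.2)%MM) (if P (mdeg m)%:Z then f@_k.1 * q@_k.2 else 0) = _); last first.
  by case: ifP => // _; rewrite big1.
apply: eq_bigr => -[m1 m2] /= /eqP/(congr1 (@mdeg _)).
rewrite mdegD => mE; rewrite mcoeff_hproj.
have [->|/hf e1] := eqVneq f@_m1 0; first by rewrite !mul0r if_same.
have -> : (mdeg m)%:Z = (mdeg m2)%:Z + e by rewrite -e1 -PoszD addnC -mE.
by case: ifP; rewrite ?mulr0.
Qed.

Lemma homogen0 k : homogen k (0 : pol).
Proof. by move=> m; rewrite mcoeff0 eqxx. Qed.

Lemma homogenD k p q : homogen k p -> homogen k q -> homogen k (p + q).
Proof.
move=> hp hq m; rewrite mcoeffD; have [->|/hp ->//] := eqVneq p@_m 0.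
by rewrite add0r => /hq.
Qed.

Lemma homogenN k p : homogen k p -> homogen k (- p).
Proof. by move=> hp m; rewrite mcoeffN oppr_eq0 => /hp. Qed.

Lemma homogen_sum k (I : Type) (r : seq I) (Q : pred I) (F : I -> pol) :
  (forall i, Q i -> homogen k (F i)) -> homogen k (\sum_(i <- r | Q i) F i).
Proof.
move=> h; elim/big_rec: _ => [|i p Qi hp]; first exact: homogen0.
exact: homogenD (h i Qi) hp.
Qed.

Lemma homogenM k e p q :
  homogen k p -> homogen e q -> homogen (k + e) (p * q).
Proof.
move=> hp hq m; rewrite mcoeffM => h.
have [[m1 m2] /= ne|h0] := pickP (fun k : 'X_{1..n < (mdeg m).+1, (mdeg m).+1} =>
    (m == (k.1 + k.2)%MM) && (p@_k.1 * q@_k.2 != 0)).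
  case/andP: ne => /eqP/(congr1 (@mdeg _)); rewrite mdegD => mE ne.
  rewrite [in LHS](congr1 Posz mE) PoszD (hp m1) ?(hq m2) //.
    by apply: contraNneq ne => ->; rewrite mulr0.
  by apply: contraNneq ne => ->; rewrite mul0r.
case/eqP: h; apply: big1 => i mi; have := h0 i; rewrite mi /=.
by move/negbT; rewrite negbK => /eqP.
Qed.

Lemma homogenZ k (c : K) p : homogen k p -> homogen k (c *: p).
Proof.
move=> hp m; rewrite mcoeffZ => ne; apply: hp.
by apply: contraNneq ne => ->; rewrite mulr0.
Qed.

Lemma homogenX i : homogen 1 ('X_i : pol).
Proof.
move=> m; rewrite mcoeffX; case: (U_(i)%MM =P m) => [<-|_]; last by rewrite eqxx.
by rewrite mdeg1.
Qed.

Lemma homogen_coeff0 k p : homogen k p -> k != 0 -> p@_0%MM = 0.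
Proof.
move=> hp k0; apply: contraNeq k0 => /hp <-.
by rewrite mdeg0.
Qed.

Lemma hproj_homogen k p : homogen k (hproj (pred1 k) p).
Proof. by move=> m; rewrite mcoeff_hproj /=; case: (_ =P k) => // _; rewrite eqxx. Qed.

Lemma hproj_id k P p : homogen k p -> P k -> hproj P p = p.
Proof.
move=> hp Pk; apply/mpolyP => m; rewrite mcoeff_hproj.
by have [->|/hp ->] := eqVneq p@_m 0; rewrite ?if_same ?Pk.
Qed.

Definition homogen_mx r s (a : 'I_r -> int) (b : 'I_s -> int)
  (A : 'M[pol]_(r, s)) := forall i j, homogen (a i - b j) (A i j).

(** The i-th basis vector has degree a i, so a term of degree j in the i-th entry has total degree j
    + a i. *)
Definition hproj_row P r (a : 'I_r -> int) (v : 'rV[pol]_r) : 'rV[pol]_r :=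
  \row_i hproj (fun j => P (j + a i)) (v 0 i).

Lemma hproj_rowM P r s (a : 'I_r -> int) (b : 'I_s -> int) (A : 'M[pol]_(r, s)) v :
  homogen_mx a b A -> hproj_row P b (v *m A) = hproj_row P a v *m A.
Proof.
move=> hA; apply/rowP => l; rewrite !mxE hproj_sum; apply: eq_bigr => k _.
rewrite mulrC (hprojM _ _ (hA k l)) !mxE mulrC; congr (_ * _).
by apply: eq_hproj => j; rewrite -addrA subrK.
Qed.

(** Truncating v = u B + l w at the degree of v makes w of lower degree, and w is again a cycle
    because l can be cancelled. Iterating, the degree falls below that of every generator, where
    only 0 is left. *)
Lemma graded_nakayama r0 r1 r2 (a0 : 'I_r0 -> int) (a1 : 'I_r1 -> int)
    (a2 : 'I_r2 -> int) (A : 'M[pol]_(r1, r0)) (B : 'M[pol]_(r2, r1)) (l : pol) :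
  homogen_mx a1 a0 A -> homogen_mx a2 a1 B -> homogen 1 l -> l != 0 ->
  (forall u : 'rV_r2, u *m B *m A = 0) ->
  (forall v : 'rV_r1, v *m A = 0 -> exists u w, v = u *m B + l *: w) ->
  forall v : 'rV_r1, v *m A = 0 -> exists u, v = u *m B.
Proof.
move=> hA hB hl l0 BA H v vA.
(* N exceeds every gap e - a1 k; each division by l lowers e by one, and N = 0 leaves no room for a
   nonzero entry. *)
have E N : forall e v, (forall k : 'I_r1, e - a1 k < N%:Z) -> v *m A = 0 ->
    hproj_row (fun j => j <= e) a1 v = v -> exists u, v = u *m B.
  elim: N => [|N IHN] e {vA} {}v he vA hv.
    exists 0; rewrite mul0mx -hv; apply/rowP => k; rewrite !mxE.
    apply/mpolyP => m; rewrite mcoeff_hproj mcoeff0; case: ifP => // h.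
    by have := he k; lia.
  have [u [w vE]] := H v vA.
  pose w' := hproj_row (fun j => j <= e - 1) a1 w.
  pose u' := hproj_row (fun j => j <= e) a2 u.
  have vE' : v = u' *m B + l *: w'.
    rewrite -(hproj_rowM _ _ hB) -[LHS]hv {1}vE; apply/rowP => k.
    rewrite !mxE hprojD; congr (_ + _); rewrite (hprojM _ _ hl); congr (_ * _).
    by apply: eq_hproj => j; lia.
  have w'A : w' *m A = 0.
    have : l *: (w' *m A) = 0.
      by rewrite scalemxAl -[l *: w'](addKr (u' *m B)) -vE' mulmxDl mulNmx BA vA oppr0 addr0.
    move=> /matrixP h; apply/matrixP => i j; have := h i j; rewrite !mxE => /eqP.
    by rewrite mulf_eq0 (negPf l0) => /eqP.
  have [||u2 w'E] := IHN (e - 1) w' _ w'A.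
  - by move=> k; have := he k; lia.
  - apply/rowP => k; rewrite !mxE; apply/mpolyP => m; rewrite !mcoeff_hproj.
    by rewrite /=; case: ifP => // ->.
  by exists (u' + l *: u2); rewrite mulmxDl -scalemxAl -w'E.
(* A crude bound for the total degrees of all terms of v. *)
pose e : int := \sum_(k < r1) ((msize (v 0 k))%:Z + `|a1 k|).
have ek (k : 'I_r1) : (msize (v 0 k))%:Z + `|a1 k| <= e.
  by rewrite /e (bigD1 k) //= lerDl sumr_ge0 // => i _; rewrite addr_ge0.
apply: (E `|(\sum_(k < r1) (`|e| + `|a1 k| + 1))%R|%N e) => //.
  move=> k; rewrite abszE ger0_norm ?sumr_ge0 //.
  rewrite (bigD1 k) //=; apply: lt_le_trans (_ : `|e| + `|a1 k| + 1 <= _); first by lia.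
  by rewrite lerDl sumr_ge0 // => i _; lia.
apply/rowP => k; rewrite !mxE; apply/mpolyP => m; rewrite mcoeff_hproj.
case: ifP => // h; rewrite memN_msupp_eq0 //; apply/negP => /msize_mdeg_lt.
by have := ek k; move: h => /=; lia.
Qed.

End Grading.

(** * Nullstellensatz *)

Lemma mpoly_ring_ind (R : comNzRingType) n (P : {mpoly R[n]} -> Prop) :
  (forall c, P c%:MP) -> (forall i, P 'X_i) ->
  (forall p q, P p -> P q -> P (p + q)) -> (forall p q, P p -> P q -> P (p * q)) ->
  forall p, P p.
Proof.
move=> hC hX hD hM p; rewrite [p]mpolyE.
elim/big_ind: _ => [||m _]; [by rewrite -mpolyC0|exact: hD|].
rewrite -mul_mpolyC; apply: (hM) => //; rewrite mpolyXE_id.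
elim/big_ind: _ => [||i _]; [by rewrite -mpolyC1|exact: hM|].
by elim: (m i) => [|k IHk]; rewrite ?expr0 -?mpolyC1 // exprS; apply: hM.
Qed.

Section WeakNullstellensatz.
Variables (K : closedFieldType) (n : nat).
Hypothesis uncountableK : forall u : nat -> K, exists z, forall k, u k <> z.
Local Notation pol := {mpoly K[n]}.

(** If each fibre lay in a finite list, the pairs (fibre, position) would enumerate K. *)
Lemma infinite_fiber (D : K -> nat) :
  exists m, forall r, exists s : seq K, [/\ uniq s, size s = r & {in s, forall a, D a = m}].
Proof.
apply: NNPP => noinf.
have cover m : exists s : seq K, forall a, D a = m -> a \in s.
  apply: NNPP => ncov; apply: noinf; exists m.
  elim=> [|r [s [us sr sD]]]; first by exists [::].
  have [a Da anots] : exists2 a, D a = m & a \notin s.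
    apply: NNPP => h; apply: ncov; exists s => a Da.
    by apply: contraT => anots; case: h; exists a.
  exists (a :: s); split; rewrite /= ?anots ?sr // => b.
  by rewrite inE => /orP[/eqP -> //|/sD].
pose s m := proj1_sig (constructive_indefinite_description _ (cover m)).
have sP m a : D a = m -> a \in s m.
  exact: (proj2_sig (constructive_indefinite_description _ (cover m))).
pose u k := if unpickle k is Some (m, j) then nth 0 (s m) j else 0.
have [z zu] := uncountableK u.
apply: (zu (pickle (D z, index z (s (D z))))).
by rewrite /u pickleK nth_index // sP.
Qed.

(** The matrix of coefficients has more rows than there are monomials of degree below D, hence a
    nonzero left kernel. *)
Lemma linear_dependence r (D : nat) (u : 'I_r -> pol) :
  (forall k, (msize (u k) <= D)%N) -> (#|{: 'X_{1..n < D}}| < r)%N ->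
  exists2 c : 'rV[K]_r, c != 0 & \sum_k c 0 k *: u k = 0.
Proof.
move=> uD Dr.
pose A := \matrix_(k < r, j < #|{: 'X_{1..n < D}}|) (u k)@_(enum_val j).
have : kermx A != 0.
  rewrite kermx_eq0 /row_free neq_ltn.
  by rewrite (leq_ltn_trans (rank_leq_col A) Dr).
case/rowV0Pn => c /sub_kermxP cA c0; exists c => //.
apply/mpolyP => m; rewrite raddf_sum mcoeff0 /=.
have [mD|Dm] := ltnP (mdeg m) D; last first.
  apply: big1 => k _; rewrite mcoeffZ memN_msupp_eq0 ?mulr0 //.
  by apply/negP => /msize_mdeg_lt h; have := leq_trans h (uD k); rewrite ltnNge Dm.
have /rowP/(_ (enum_rank (BMultinom mD))) := cA; rewrite !mxE => {2}<-.
by apply: eq_bigr => k _; rewrite mxE enum_rankK mcoeffZ.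
Qed.

(* If X_i - a were invertible modulo J for every a, then among the uncountably
   many inverses infinitely many would have the same degree, hence be linearly
   dependent; clearing denominators gives a nonzero polynomial in X_i in J, and
   this splits into factors invertible modulo J. *)
Lemma proper_ideal_specialize (J : pol -> Prop) (i : 'I_n) :
  is_ideal J -> ~ J 1 -> exists a, forall u, ~ J (1 - u * ('X_i - a%:MP)).
Proof.
move=> idJ J1; apply: NNPP => h.
have inv a : exists u, J (1 - u * ('X_i - a%:MP)).
  by apply: NNPP => h'; apply: h; exists a => u Ju; apply: h'; exists u.
pose u a := proj1_sig (constructive_indefinite_description _ (inv a)).
have uP a : J (1 - u a * ('X_i - a%:MP)).
  exact: (proj2_sig (constructive_indefinite_description _ (inv a))).
have split (zs : seq K) : J (\prod_(z <- zs) ('X_i - z%:MP)) -> J 1.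
  elim: zs => [|z zs IHzs]; first by rewrite big_nil.
  rewrite big_cons; set q := \prod_(_ <- _) _ => Jq; apply: IHzs; rewrite -/q.
  have -> : q = u z * (('X_i - z%:MP) * q) + (1 - u z * ('X_i - z%:MP)) * q by ring.
  by apply: idealD => //; [apply: idealMl|apply: idealMr].
have cX : commr_rmorph (@mpolyC n K) ('X_i : pol) by move=> z; apply: mulrC.
pose ev : {rmorphism {poly K} -> pol} := horner_morph cX.
have evC z : ev z%:P = z%:MP by apply: horner_morphC.
have evX z : ev ('X - z%:P) = 'X_i - z%:MP.
  by rewrite rmorphB evC; congr (_ - _); apply: horner_morphX.
have nonzero (Q : {poly K}) : Q != 0 -> J (ev Q) -> J 1.
  move=> Q0; have [zs ->] := closed_field_poly_normal Q.
  rewrite -mul_polyC rmorphM rmorph_prod evC => JQ.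
  apply: (split zs).
  have -> : \prod_(z <- zs) ('X_i - z%:MP) = (lead_coef Q)^-1%:MP *
      ((lead_coef Q)%:MP * \prod_(z <- zs) ev ('X - z%:P)).
    rewrite mulrA -mpolyCM mulVf ?lead_coef_eq0 // mpolyC1 mul1r.
    by apply: eq_bigr => z _; rewrite evX.
  exact: idealMl.
have [m hm] := infinite_fiber (fun a => msize (u a)).
have [s [us sz sm]] := hm #|{: 'X_{1..n < m}}|.+1.
have [||c c0 cu] := @linear_dependence (size s) m (fun k => u s`_k).
- by move=> k; rewrite sm // mem_nth.
- by rewrite sz.
(* The numerator of the sum of c_k / (X - s_k). It is nonzero, since at s_k only the k-th summand
   survives and some c_k is nonzero. *)
pose Q := \sum_(k < size s) c 0 k *: \prod_(j < size s | j != k) ('X - (s`_j)%:P).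
apply/J1/(nonzero Q).
  have [k ck] : exists k, c 0 k != 0 by apply/rV0Pn.
  apply/eqP => /(congr1 (fun p => p.[s`_k])) /eqP; rewrite horner0; apply/negP.
  rewrite horner_sum (bigD1 k) //= [X in _ + X]big1 ?addr0; last first.
    move=> j jk; rewrite hornerZ horner_prod (bigD1 k) 1?eq_sym //=.
    by rewrite hornerXsubC subrr mul0r mulr0.
  rewrite hornerZ mulf_neq0 // horner_prod prodf_seq_neq0.
  apply/allP => j _; apply/implyP => jk.
  by rewrite hornerXsubC subr_eq0 nth_uniq // eq_sym.
have -> : ev Q = \sum_(k < size s) (c 0 k)%:MP *
    \prod_(j < size s | j != k) ('X_i - (s`_j)%:MP).
  rewrite rmorph_sum; apply: eq_bigr => k _.
  rewrite -mul_polyC rmorphM rmorph_prod evC; congr (_ * _).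
  by apply: eq_bigr => j _; rewrite evX.
have -> : \sum_(k < size s) (c 0 k)%:MP * \prod_(j < size s | j != k) ('X_i - (s`_j)%:MP)
    = \sum_(k < size s) (c 0 k)%:MP * \prod_(j < size s | j != k) ('X_i - (s`_j)%:MP) *
       (1 - u s`_k * ('X_i - (s`_k)%:MP))
    + \prod_(j < size s) ('X_i - (s`_j)%:MP) * \sum_k c 0 k *: u s`_k.
  rewrite mulr_sumr -big_split /=; apply: eq_bigr => k _.
  rewrite [\prod_(j < size s) _](bigD1 k) //= -mul_mpolyC; ring.
rewrite cu mulr0 addr0; apply: ideal_sum => // k _; exact: idealMl.
Qed.

(** Specializing one variable at a time gives a proper ideal containing J and every X_i - a_i.
    Modulo it p is the constant p(a), which must vanish when p is in J. *)
Theorem weak_nullstellensatz (J : pol -> Prop) :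
  is_ideal J -> ~ J 1 -> exists x : 'I_n -> K, forall p, J p -> p.@[x] = 0.
Proof.
move=> idJ J1.
have chain k : (k <= n)%N -> exists J' a, [/\ is_ideal J', forall p, J p -> J' p,
    ~ J' 1 & forall i : 'I_n, (i < k)%N -> J' ('X_i - (a i)%:MP)].
  elim: k => [|k IHk] kn; first by exists J, (fun=> 0).
  have [J' [a [idJ' JJ' J'1 J'a]]] := IHk (ltnW kn).
  have [b hb] := proper_ideal_specialize (Ordinal kn) idJ' J'1.
  exists (adjoin J' ('X_(Ordinal kn) - b%:MP)).
  exists (fun i : 'I_n => if i == k :> nat then b else a i).
  split=> [|p /JJ'|[u /hb//]|i]; [exact: adjoin_ideal|exact: adjoin_sub|].
  rewrite ltnS leq_eqVlt; case: eqP => [ik _|_ /= ik].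
    have -> : i = Ordinal kn by apply: val_inj.
    exact: adjoin_self.
  by apply: adjoin_sub; apply: J'a.
have [J' [a [idJ' JJ' J'1 J'a]]] := chain n (leqnn n).
exists a => p /JJ' J'p.
have congr : J' (p - p.@[a]%:MP).
  elim/mpoly_ring_ind: p {J'p} => [c|i|p q hp hq|p q hp hq].
  - by rewrite mevalC subrr; apply: ideal0.
  - by rewrite mevalXU; apply: J'a.
  - by rewrite mevalD mpolyCD opprD addrACA; apply: idealD.
  - have -> : p * q - (p * q).@[a]%:MP = (p - p.@[a]%:MP) * q + p.@[a]%:MP * (q - q.@[a]%:MP).
      by rewrite mevalM mpolyCM; ring.
    by apply: idealD => //; [apply: idealMr|apply: idealMl].
apply/eqP; apply: contraT => pa; case: J'1.
have -> : 1 = (p.@[a])^-1%:MP * (p - (p - p.@[a]%:MP)).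
  by rewrite subKr -mpolyCM mulVf // mpolyC1.
by apply: idealMl => //; apply: idealB.
Qed.

End WeakNullstellensatz.

(* If 1 = u (x_i - 1) modulo J, then u has homogeneous components -x_i^k modulo J,
   which vanish for large k. *)
Lemma graded_nullstellensatz (K : closedFieldType) n (J : {mpoly K[n]} -> Prop) :
  (forall u : nat -> K, exists z, forall k, u k <> z) ->
  is_ideal J -> (forall k p, J p -> J (hproj (pred1 k) p)) ->
  (forall x : 'I_n -> K, (forall p, J p -> p.@[x] = 0) -> forall i, x i = 0) ->
  forall i, exists N, J ('X_i ^+ N).
Proof.
move=> uncK idJ homJ zeroJ i.
(* At a zero of J the coordinate x_i is 0, so x_i - 1 has no zero in common with J. *)
have [u Ju] : adjoin J ('X_i - 1) 1.
  apply: NNPP => /(weak_nullstellensatz uncK (adjoin_ideal idJ _))[x xJ'].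
  have x0 : x i = 0 by apply: zeroJ => p Jp; apply: xJ'; apply: adjoin_sub.
  have /eqP : ('X_i - 1 : {mpoly K[n]}).@[x] = 0 by apply: xJ'; apply: adjoin_self.
  by rewrite mevalB mevalXU meval1 x0 sub0r oppr_eq0 oner_eq0.
pose c k := hproj (pred1 k%:Z) u.
have hX := @homogenX K n i.
(* The component of degree k of 1 + u - x_i u; modulo J it yields c_0 = -1 and c_k = x_i c_(k-1). *)
have homE k : hproj (pred1 k%:Z) (1 - u * ('X_i - 1)) =
    (k == 0%N)%:R + c k - 'X_i * hproj (fun j => j + 1 == k%:Z) u.
  have -> : 1 - u * ('X_i - 1) = 1 + u + 'X_i * (- u) by ring.
  rewrite !hprojD (hprojM _ _ hX) hproj1 /= eqz_nat (eq_sym 0%N) -/(c k) -mulrN.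
  congr (_ + _ + _ * _).
  by apply/mpolyP => m; rewrite mcoeffN !mcoeff_hproj mcoeffN /=; case: ifP; rewrite ?oppr0.
have Jc k : J (c k + 'X_i ^+ k).
  elim: k => [|k IHk].
    have := homJ 0 _ Ju; rewrite (homE 0%N) eqxx (_ : hproj _ u = 0).
      by rewrite mulr0 subr0 addrC.
    by apply/mpolyP => m; rewrite mcoeff_hproj mcoeff0; case: eqP => //; lia.
  have -> : c k.+1 + 'X_i ^+ k.+1 = (c k.+1 - 'X_i * c k) + 'X_i * (c k + 'X_i ^+ k).
    by rewrite exprS; ring.
  apply: idealD => //; last exact: idealMl.
  have := homJ k.+1%:Z _ Ju; rewrite (homE k.+1) /= add0r (_ : hproj _ u = c k) //.
  by apply: eq_hproj => j /=; lia.
exists (msize u); have := Jc (msize u); rewrite (_ : c _ = 0) ?add0r //.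
apply/mpolyP => m; rewrite mcoeff_hproj mcoeff0 /=; case: eqP => // -[mu].
by apply: memN_msupp_eq0; apply/negP => /msize_mdeg_lt; rewrite mu ltnn.
Qed.

(** * The ideals (l, x_1^N, ..., x_j^N) *)

Section LinearSection.
Variables (K : fieldType) (n N : nat) (a : 'I_n.+1 -> K).
Hypothesis a0 : a ord0 = 1.
Local Notation pol := {mpoly K[n.+1]}.

Definition linear_form : pol := \sum_i a i *: 'X_i.
Local Notation l := linear_form.

Lemma linear_form_homogen : homogen 1 l.
Proof. by apply: homogen_sum => i _; apply/homogenZ/homogenX. Qed.

Lemma linear_formE : l = 'X_ord0 + \sum_(i | i != ord0) a i *: 'X_i.
Proof. by rewrite /linear_form (bigD1 ord0) //= a0 scale1r. Qed.

Lemma linear_form_neq0 : l != 0.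
Proof.
apply/eqP => /(congr1 (mcoeff U_(ord0))); rewrite mcoeff0 linear_formE mcoeffD mcoeffXU eqxx.
rewrite raddf_sum big1 /= ?addr0 => [/eqP|i /negPf i0]; first by rewrite oner_eq0.
by rewrite mcoeffZ mcoeffXU i0 mulr0.
Qed.

(* Solves l = 0 for x_0, which is possible since a_0 = 1; the kernel is (l). *)
Definition elim0 (p : pol) : pol :=
  p \mPo [tuple if i == ord0 then 'X_i - l else 'X_i | i < n.+1].

Lemma elim0X i : elim0 'X_i = if i == ord0 then 'X_i - l else 'X_i.
Proof. by rewrite /elim0 comp_mpolyXU -tnth_nth tnth_mktuple. Qed.

Lemma elim0_linear_form : elim0 l = 0.
Proof.
have h : elim0 (\sum_(i | i != ord0) a i *: 'X_i) = \sum_(i | i != ord0) a i *: 'X_i.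
  rewrite /elim0 raddf_sum; apply: eq_bigr => i /negPf i0 /=.
  by rewrite comp_mpolyZ -/(elim0 _) elim0X i0.
rewrite {1}linear_formE /elim0 comp_mpolyD -!/(elim0 _) h elim0X eqxx linear_formE.
ring.
Qed.

(** The recursion has the form of [J_succ], which then holds by conversion. The powers start at x_1,
    since l = 0 is solved for x_0. *)
Fixpoint section_ideal j (p : pol) : Prop :=
  if j is j'.+1 then exists q, section_ideal j' (p - 'X_(inord j) ^+ N * q)
  else exists q, p = l * q.

Lemma section_ideal_ideal j : is_ideal (section_ideal j).
Proof.
elim: j => [|j IHj] /=.
  split; first by exists 0; rewrite mulr0.
    by move=> p q [u ->] [v ->]; exists (u + v); rewrite mulrDr.
  by move=> p q [u ->]; exists (p * u); rewrite mulrCA.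
split; first by exists 0; rewrite mulr0 subr0; apply: ideal0.
  move=> p q [u hu] [v hv]; exists (u + v).
  by have := idealD IHj hu hv; rewrite mulrDr opprD addrACA.
move=> p q [u hu]; exists (p * u).
by have := idealMl IHj p hu; rewrite mulrBr mulrCA.
Qed.

Lemma section_idealS j p : section_ideal j p -> section_ideal j.+1 p.
Proof. by exists 0; rewrite mulr0 subr0. Qed.

Lemma section_idealX j (i : 'I_n.+1) : (0 < i <= j)%N -> section_ideal j ('X_i ^+ N).
Proof.
elim: j => [|j IHj]; first by case: (nat_of_ord i).
rewrite [(i <= _)%N]leq_eqVlt => /andP[i0 /orP[/eqP ij|ij]]; last first.
  by apply/section_idealS/IHj; rewrite i0.
exists 1; rewrite mulr1 -ij inord_val subrr.
exact: (ideal0 (section_ideal_ideal j)).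
Qed.

(** [elim0] is a ring morphism that moves each generator by a multiple of l. *)
Lemma section_ideal_elim0 j p : section_ideal j (p - elim0 p).
Proof.
elim: j => [|j IHj]; last exact: section_idealS.
elim/mpoly_ring_ind: p => [c|i|p q [u hu] [v hv]|p q [u hu] [v hv]].
- by exists 0; rewrite /elim0 comp_mpolyC subrr mulr0.
- rewrite elim0X; case: ifP => _; last by exists 0; rewrite subrr mulr0.
  by exists 1; rewrite subKr mulr1.
- by exists (u + v); rewrite /elim0 comp_mpolyD opprD addrACA hu hv mulrDr.
- exists (u * q + elim0 p * v).
  rewrite mulrDr mulrA -hu mulrCA -hv.
  rewrite /elim0 rmorphM /=; ring.
Qed.

Definition monomial_in j (m : 'X_{1..n.+1}) :=
  [exists i : 'I_n.+1, (0 < i <= j)%N && (N <= m i)%N].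

Lemma elim0M p q : elim0 (p * q) = elim0 p * elim0 q.
Proof. by rewrite /elim0 rmorphM. Qed.

Lemma elim0_powX (i : 'I_n.+1) q : (0 < i)%N ->
  elim0 ('X_i ^+ N * q) = elim0 q * 'X_[U_(i) *+ N].
Proof.
move=> i0; rewrite elim0M {1}/elim0 rmorphXn /= -/(elim0 _) elim0X.
by rewrite -val_eqE /= eqn0Ngt i0 mpolyXn mulrC.
Qed.

(** After elimination of x_0 the ideal is monomial, so membership is decided on the support of
    [elim0 p]. *)
Lemma section_idealP j p : (j <= n)%N -> section_ideal j p <->
  {in msupp (elim0 p), forall m, monomial_in j m}.
Proof.
move=> jn; split.
  elim: j jn p => [|j IHj] jn p /=.
    by case=> q ->; rewrite elim0M elim0_linear_form mul0r msupp0.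
  have ij : (inord j.+1 : 'I_n.+1) = j.+1 :> nat by rewrite inordK.
  case=> q /(IHj (ltnW jn)) hm m.
  have -> : p = (p - 'X_(inord j.+1) ^+ N * q) + 'X_(inord j.+1) ^+ N * q by rewrite subrK.
  rewrite {1}/elim0 comp_mpolyD => /msuppD_le; rewrite mem_cat => /orP[/hm|].
    case/existsP => i /andP[/andP[i0 ji] Ni]; apply/existsP; exists i.
    by rewrite i0 Ni leqW.
  rewrite -/(elim0 _) elim0_powX ?ij // (perm_mem (msuppMX _ _)) => /mapP[m' _ ->].
  apply/existsP; exists (inord j.+1); rewrite ij leqnn mnmDE mulmnE mnm1E eqxx mul1n.
  by rewrite leq_addr.
move=> hm; have idJ := section_ideal_ideal j.
rewrite -[p](subrK (elim0 p)); apply: idealD (section_ideal_elim0 _ _) _ => //.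
rewrite [elim0 p]mpolyE big_seq; apply: ideal_sum => // m /hm/existsP[i /andP[ij Ni]].
rewrite -mul_mpolyC; apply: idealMl => //.
have -> : m = ((m - U_(i) *+ N) + U_(i) *+ N)%MM.
  apply/mnmP => k; rewrite mnmDE mnmBE mulmnE mnm1E.
  by case: eqP => [<-|_]; rewrite ?mul1n ?mul0n ?subnK // addn0 subn0.
by rewrite mpolyXD -mpolyXn; apply: idealMl => //; apply: section_idealX.
Qed.

(** Multiplication by x_(j+1)^N leaves the exponents of x_1, ..., x_j unchanged, and only these
    decide membership. *)
Lemma section_ideal_regular j p : (j < n)%N ->
  section_ideal j ('X_(inord j.+1) ^+ N * p) -> section_ideal j p.
Proof.
move=> jn /(section_idealP _ (ltnW jn)) hm; apply/(section_idealP _ (ltnW jn)) => m mp.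
have ij : (inord j.+1 : 'I_n.+1) = j.+1 :> nat by rewrite inordK.
have /hm/existsP[i /andP[/andP[i0 ji] Ni]] :
    (U_(inord j.+1) *+ N + m)%MM \in msupp (elim0 ('X_(inord j.+1) ^+ N * p)).
  by rewrite elim0_powX ?ij // (perm_mem (msuppMX _ _)) mem_map //; apply: addmI.
apply/existsP; exists i; rewrite i0 ji; move: Ni.
rewrite mnmDE mulmnE mnm1E -val_eqE /= ij.
by rewrite eq_sym (ltn_eqF (leq_ltn_trans ji (ltnSn j))) mul0n add0n.
Qed.

End LinearSection.

(** * Uniqueness of minimal graded resolutions *)

(** A nonzero determinant has a nonzero term in its expansion; the permutation of that term matches
    a with b. *)
Lemma perm_eq_unit_matrix (K : fieldType) (T : eqType) r s (A : 'M[K]_(r, s))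
    (B : 'M[K]_(s, r)) (a : 'I_r -> T) (b : 'I_s -> T) :
  A *m B = 1%:M -> B *m A = 1%:M -> (forall k l, A k l != 0 -> a k = b l) ->
  perm_eq [seq a k | k <- enum 'I_r] [seq b l | l <- enum 'I_s].
Proof.
move=> AB BA.
have rs : r = s by apply/eqP; rewrite eqn_leq (mulmx1_min AB) (mulmx1_min BA).
case: s / rs A B b AB BA => A B b AB _ Aab.
have [uA _] := mulmx1_unit AB.
have /existsP[t /forallP tA] : [exists t : 'S_r, [forall k, A k (t k) != 0]].
  apply: contraTT uA => /existsPn h.
  rewrite unitmxE unitfE negbK /determinant big1 // => t _.
  have /forallPn[k] := h t; rewrite negbK => /eqP Ak.
  by rewrite (bigD1 k) //= Ak mul0r mulr0.
have -> : [seq a k | k <- enum 'I_r] = [seq b l | l <- [seq t k | k <- enum 'I_r]].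
  by rewrite -[RHS]map_comp; apply: eq_map => k; apply: Aab.
apply/perm_map/uniq_perm; rewrite ?enum_uniq ?(map_inj_uniq perm_inj) ?enum_uniq //.
move=> l; rewrite mem_enum; apply/mapP; exists (t^-1%g l); rewrite ?mem_enum ?permKV //.
Qed.

Lemma lift_rows (R : nzRingType) r s t (A : 'M[R]_(r, t)) (B : 'M[R]_(s, t)) :
  (forall k, exists w, row k A = w *m B) -> exists W, A = W *m B.
Proof.
move=> /fin_all_exists[w wP]; exists (\matrix_k w k).
by apply/row_matrixP => k; rewrite row_mul rowK wP.
Qed.

Section MinimalComplexes.
Variables (K : fieldType) (n : nat).
Local Notation pol := {mpoly K[n]}.

Definition hproj_mx r s (a : 'I_r -> int) (b : 'I_s -> int) (A : 'M[pol]_(r, s)) :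
  'M[pol]_(r, s) := \matrix_(k, l) hproj (pred1 (a k - b l)) (A k l).

Lemma hproj_mx_homogen r s (a : 'I_r -> int) (b : 'I_s -> int) A :
  homogen_mx a b (hproj_mx a b A).
Proof. by move=> k l; rewrite mxE; apply: hproj_homogen. Qed.

Lemma hproj_mx_id r s (a : 'I_r -> int) (b : 'I_s -> int) (A : 'M[pol]_(r, s)) :
  homogen_mx a b A -> hproj_mx a b A = A.
Proof.
by move=> hA; apply/matrixP => k l; rewrite mxE (hproj_id (hA k l)) //=.
Qed.

Lemma hproj_mxM r s t (a : 'I_r -> int) (b : 'I_s -> int) (c : 'I_t -> int)
    (A : 'M[pol]_(r, s)) (B : 'M[pol]_(s, t)) :
  homogen_mx b c B -> hproj_mx a c (A *m B) = hproj_mx a b A *m B.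
Proof.
move=> hB; apply/matrixP => k l; rewrite !mxE hproj_sum; apply: eq_bigr => j _.
rewrite mulrC (hprojM _ _ (hB j l)) mxE mulrC; congr (_ * _).
by apply: eq_hproj => x /=; lia.
Qed.

Lemma homogen_mxM r s t (a : 'I_r -> int) (b : 'I_s -> int) (c : 'I_t -> int)
    (A : 'M[pol]_(r, s)) (B : 'M[pol]_(s, t)) :
  homogen_mx a b A -> homogen_mx b c B -> homogen_mx a c (A *m B).
Proof.
move=> hA hB k l; rewrite mxE; apply: homogen_sum => j _.
have -> : a k - c l = (a k - b j) + (b j - c l) by rewrite addrA subrK.
exact: homogenM.
Qed.

(** The part of the right degrees of any lift is again a lift, because A and B are homogeneous. *)
Lemma graded_lift r s t (a : 'I_r -> int) (b : 'I_s -> int) (c : 'I_t -> int)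
    (A : 'M[pol]_(r, t)) (B : 'M[pol]_(s, t)) :
  homogen_mx a c A -> homogen_mx b c B -> (forall k, exists w, row k A = w *m B) ->
  exists2 W, homogen_mx a b W & A = W *m B.
Proof.
move=> hA hB /lift_rows[W AE]; exists (hproj_mx a b W); first exact: hproj_mx_homogen.
by rewrite -(hproj_mxM _ _ hB) -AE hproj_mx_id.
Qed.

(** Exactness is asked at positive indices only; at index 0 the cokernel is the module being
    resolved. *)
Record graded_complex := GradedComplex {
  cx_rank : nat -> nat;
  cx_deg : forall i, 'I_(cx_rank i) -> int;
  cx_d : forall i, 'M[pol]_(cx_rank i.+1, cx_rank i);
  cx_homogen : forall i, homogen_mx (@cx_deg i.+1) (@cx_deg i) (cx_d i);
  cx_exact : forall i (v : 'rV_(cx_rank i.+1)), v *m cx_d i = 0 <-> exists w, v = w *m cx_d i.+1 }.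
Implicit Types F G : graded_complex.

Definition const_mx0 r s (A : 'M[pol]_(r, s)) : 'M[K]_(r, s) := map_mx (mcoeff 0%MM) A.

Definition minimal_complex F := forall i, const_mx0 (cx_d F i.+1) = 0.

(** The induction invariant for a self-map lifting the identity. On cycles the [d s] half of a
    homotopy to the identity vanishes, so one map s suffices. *)
Definition near_identity F i (M : 'M[pol]_(cx_rank F i.+1)) :=
  const_mx0 M = 1%:M /\ exists s, forall v : 'rV_(cx_rank F i.+1),
    v *m cx_d F i = 0 -> v *m (M - 1%:M) = v *m s *m cx_d F i.+1.

Lemma const_mx0M r s t (A : 'M[pol]_(r, s)) (B : 'M[pol]_(s, t)) :
  const_mx0 (A *m B) = const_mx0 A *m const_mx0 B.
Proof. exact: map_mxM. Qed.

(** M - 1 has its rows in the kernel of A, hence factors through the next differential, which has no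
    constant terms. *)
Lemma near_identity0 F t (A : 'M[pol]_(cx_rank F 1, t)) (M : 'M[pol]_(cx_rank F 1)) :
  minimal_complex F -> (forall v : 'rV_(cx_rank F 1), v *m A = 0 -> v *m cx_d F 0 = 0) ->
  M *m A = A -> near_identity M.
Proof.
move=> minF kerA MA.
have [s sE] : exists s, M - 1%:M = s *m cx_d F 1.
  apply: lift_rows => k; apply/cx_exact/kerA.
  by rewrite -row_mul mulmxBl mul1mx MA subrr row0.
split; last by exists s => v _; rewrite sE mulmxA.
have -> : M = 1%:M + s *m cx_d F 1 by rewrite -sE addrC subrK.
by rewrite /const_mx0 map_mxD map_mx1 -/(const_mx0 _) const_mx0M minF mulmx0 addr0.
Qed.

(* If M - 1 = s d on cycles, then M' - 1 - d s maps to cycles, so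
   M' - 1 = d s + s' d', whose constant terms vanish by minimality. *)
Lemma near_identityS F i (M : 'M[pol]_(cx_rank F i.+1)) (M' : 'M[pol]_(cx_rank F i.+2)) :
  minimal_complex F -> cx_d F i.+1 *m M = M' *m cx_d F i.+1 ->
  near_identity M -> near_identity M'.
Proof.
move=> minF dM [_ [s sE]]; set d := cx_d F i.+1 in dM sE *.
have dd : d *m cx_d F i = 0.
  apply/row_matrixP => k; rewrite row_mul row0; apply/cx_exact.
  by exists (delta_mx 0 k); rewrite rowE.
have [s' s'E] : exists s', M' - 1%:M - d *m s = s' *m cx_d F i.+2.
  apply: lift_rows => k; apply/cx_exact; rewrite -row_mul.
  suff -> : (M' - 1%:M - d *m s) *m d = 0 by rewrite row0.
  rewrite !mulmxBl mul1mx -dM -{2}[d]mulmx1 -mulmxBr; apply/row_matrixP => j.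
  rewrite row0 linearB /= !row_mul sE ?subrr // -row_mul dd row0 //.
have M'E : M' = 1%:M + (d *m s + s' *m cx_d F i.+2).
  by rewrite -s'E [d *m s + _]addrC subrK addrC subrK.
split.
  rewrite M'E /const_mx0 !map_mxD map_mx1 -!/(const_mx0 _) !const_mx0M !minF.
  by rewrite mul0mx mulmx0 !addr0.
by exists s' => v vd; rewrite M'E addrC addKr mulmxDr !mulmxA vd !mul0mx add0r.
Qed.

Definition chain_lift F G i (P : 'M[pol]_(cx_rank F i.+1, cx_rank G i.+1)) :=
  homogen_mx (@cx_deg F i.+1) (@cx_deg G i.+1) P /\
  forall v : 'rV_(cx_rank F i.+1), v *m cx_d F i = 0 -> v *m P *m cx_d G i = 0.

Lemma chain_liftS F G i (P : 'M[pol]_(cx_rank F i.+1, cx_rank G i.+1)) :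
  chain_lift P -> exists P' : 'M[pol]_(cx_rank F i.+2, cx_rank G i.+2),
    cx_d F i.+1 *m P = P' *m cx_d G i.+1 /\ chain_lift P'.
Proof.
case=> hP kerP.
have [|||P' hP' PE] := @graded_lift _ _ _ (@cx_deg F i.+2) (@cx_deg G i.+2)
    (@cx_deg G i.+1) (cx_d F i.+1 *m P) (cx_d G i.+1).
- exact: (homogen_mxM (@cx_homogen F i.+1) hP).
- exact: (@cx_homogen G i.+1).
- move=> k; apply/cx_exact; rewrite row_mul; apply: kerP; apply/cx_exact.
  by exists (delta_mx 0 k); rewrite rowE.
exists P'; split=> //; split=> // v vd.
by rewrite -mulmxA -PE mulmxA vd mul0mx.
Qed.

(** A and B replay the differentials of index 0 with a common target, since [cx_rank F 0] and
    [cx_rank G 0] are a priori unrelated. The lifts of A through B and of B through A start the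
    comparison. *)
Theorem minimal_complex_deg F G t (c : 'I_t -> int)
    (A : 'M[pol]_(cx_rank F 1, t)) (B : 'M[pol]_(cx_rank G 1, t)) :
  minimal_complex F -> minimal_complex G ->
  homogen_mx (@cx_deg F 1) c A -> homogen_mx (@cx_deg G 1) c B ->
  (forall v : 'rV_(cx_rank F 1), v *m A = 0 <-> v *m cx_d F 0 = 0) ->
  (forall v : 'rV_(cx_rank G 1), v *m B = 0 <-> v *m cx_d G 0 = 0) ->
  (forall u : 'rV_t, (exists v, u = v *m A) <-> exists w, u = w *m B) ->
  forall i, perm_eq [seq cx_deg k | k <- enum 'I_(cx_rank F i.+1)]
    [seq cx_deg k | k <- enum 'I_(cx_rank G i.+1)].
Proof.
move=> minF minG hA hB kerA kerB AB i.
have start : exists (P : 'M_(cx_rank F 1, cx_rank G 1)) (Q : 'M_(cx_rank G 1, cx_rank F 1)),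
    [/\ chain_lift P, chain_lift Q, near_identity (P *m Q) & near_identity (Q *m P)].
  have [|P hP PE] := graded_lift hA hB.
    by move=> k; apply/AB; exists (delta_mx 0 k); rewrite rowE.
  have [|Q hQ QE] := graded_lift hB hA.
    by move=> k; apply/AB; exists (delta_mx 0 k); rewrite rowE.
  exists P, Q; split.
  - by split=> // v /kerA vA; apply/kerB; rewrite -mulmxA -PE.
  - by split=> // v /kerB vB; apply/kerA; rewrite -mulmxA -QE.
  - by apply: (near_identity0 minF (fun v => (kerA v).1)); rewrite -mulmxA -QE -PE.
  - by apply: (near_identity0 minG (fun v => (kerB v).1)); rewrite -mulmxA -PE -QE.
have [P [Q [[hP _] _ [PQ _] [QP _]]]] : exists (P : 'M_(cx_rank F i.+1, cx_rank G i.+1))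
    (Q : 'M_(cx_rank G i.+1, cx_rank F i.+1)),
    [/\ chain_lift P, chain_lift Q, near_identity (P *m Q) & near_identity (Q *m P)].
  elim: i => // i [P [Q [liftP liftQ PQ QP]]].
  have [P' [PE liftP']] := chain_liftS liftP.
  have [Q' [QE liftQ']] := chain_liftS liftQ.
  exists P', Q'; split=> //.
    by apply: near_identityS PQ => //; rewrite mulmxA PE -!mulmxA QE.
  by apply: near_identityS QP => //; rewrite mulmxA QE -!mulmxA PE.
apply: (@perm_eq_unit_matrix _ _ _ _ (const_mx0 P) (const_mx0 Q)).
- by rewrite -const_mx0M.
- by rewrite -const_mx0M.
move=> k l; rewrite mxE => /hP; rewrite mdeg0 => /esym/eqP.
by rewrite subr_eq0 => /eqP.
Qed.

End MinimalComplexes.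

(** * The ideal of minors *)

Lemma exists_nonroot (K : closedFieldType) (q : {poly K}) :
  (forall u : nat -> K, exists z, forall k, u k <> z) -> q != 0 -> exists z, q.[z] != 0.
Proof.
move=> uncK q0; have [zs qE] := closed_field_poly_normal q.
have [z hz] := uncK (nth 0 zs); exists z.
rewrite qE hornerZ mulf_neq0 ?lead_coef_eq0 // horner_prod prodf_seq_neq0.
apply/allP => y yzs; rewrite hornerXsubC subr_eq0.
by apply/eqP => zy; apply: (hz (index y zs)); rewrite nth_index.
Qed.

(** The coefficients are 1, t, ..., t^n on the moment curve: a nonzero y is orthogonal to them only
    if t is a root of the polynomial with coefficients y. Zero vectors in s get the factor 1, so
    that the product stays nonzero. *)
Lemma exists_generic_hyperplane (K : closedFieldType) n (s : seq ('I_n.+1 -> K)) :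
  (forall u : nat -> K, exists z, forall k, u k <> z) ->
  exists2 a : 'I_n.+1 -> K, a ord0 = 1 &
    forall y, List.In y s -> \sum_i a i * y i = 0 -> forall i, y i = 0.
Proof.
move=> uncK.
pose py (y : 'I_n.+1 -> K) : {poly K} := \poly_(i < n.+1) y (inord i).
pose q := \prod_(y <- s) (if py y == 0 then 1 else py y).
have q0 : q != 0.
  rewrite /q; elim/big_rec: _ => [|y r _ r0]; first exact: oner_neq0.
  by rewrite mulf_neq0 //; case: ifP => [_|/negbT //]; apply: oner_neq0.
have [t qt] := exists_nonroot uncK q0.
exists (fun i => t ^+ i) => [|y ys yt i]; first exact: expr0.
have pyt : (py y).[t] = 0.
  rewrite horner_poly -[RHS]yt; apply: eq_bigr => j _.
  by rewrite inord_val mulrC.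
have : py y = 0.
  apply/eqP; apply: contraNT qt => py0; rewrite /q.
  elim: s ys {q q0} => //= z s IHs [->|ys]; rewrite big_cons hornerM.
    by rewrite (negPf py0) pyt mul0r.
  by rewrite (eqP (IHs ys)) mulr0.
move/(congr1 (fun p : {poly K} => p`_i)); rewrite coef_poly coef0 ltn_ord.
by rewrite inord_val.
Qed.

(** * Entries of the differentials and multiplicities of the labels *)

Section ENLabels.
Variables (R : comNzRingType) (N : nat) (x g : 'I_N -> R).

Lemma chain_of_delta i (k : 'I_#|en_basis N i|) b S :
  chain_of (delta_mx 0 k : 'rV[R]__) b S =
  (((en_label k).1 == S) && ((en_label k).2 == b :> nat))%:R.
Proof.
rewrite ffunE (bigD1 k) //= mxE !eqxx mul1r big1 ?addr0 // => j jk.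
by rewrite mxE (negPf jk) mul0r.
Qed.

Lemma en_mxSE i (k : 'I_#|en_basis N i.+1|) (l : 'I_#|en_basis N i|) :
  en_mx x g i.+1 k l = en_diff x g (chain_of (delta_mx 0 k)) (en_label l).2 (en_label l).1.
Proof. by rewrite !mxE. Qed.

Lemma en_mx0E (k : 'I_#|en_basis N 0|) l :
  en_mx x g 0 k l = en_aug x g (chain_of (delta_mx 0 k)).
Proof. by rewrite !mxE. Qed.

Lemma pos_sign_pm1 i (S : {set 'I_N}) : exists c : nat, pos_sign R i S = (-1) ^+ c.
Proof.
rewrite /pos_sign; elim/big_rec: _ => [|j _ _ [c ->]]; first by exists 0%N.
by exists ((j < i) + c)%N; rewrite exprD.
Qed.

(** Every term of an entry contains some x_j or g_j. With the constant term as [phi] this is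
    minimality. *)
Lemma en_mxS_vanish (S : comNzRingType) (phi : {rmorphism R -> S}) i
    (k : 'I_#|en_basis N i.+1|) (l : 'I_#|en_basis N i|) :
  (forall j, phi (x j) = 0) -> (forall j, phi (g j) = 0) -> phi (en_mx x g i.+1 k l) = 0.
Proof.
move=> phix phig; rewrite en_mxSE /en_diff ffunE rmorphD /=.
rewrite !koszulE !rmorph_sum !big1 ?addr0 // => j _; rewrite !rmorphM.
  by rewrite phig !mul0r.
by rewrite phix !mul0r.
Qed.

End ENLabels.

(** Each b <= i is paired with all the subsets of size i+2. *)
Lemma en_label_perm (T : eqType) N i (f : nat -> T) :
  perm_eq [seq f (en_label k).2 | k <- enum 'I_#|en_basis N i|]
    (flatten [seq nseq 'C(N, i.+2) (f j) | j <- iota 0 i.+1]).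
Proof.
apply/seq.permP => a; rewrite count_flatten -map_comp sumnE big_map.
rewrite -[iota 0 i.+1]/(index_iota 0 i.+1) big_mkord -sum1_count big_map big_mkcond big_enum.
pose G j := (if a (f j) then 1 else 0)%N.
transitivity (\sum_(s in en_basis N i) G s.2)%N.
  by rewrite [RHS]big_enum_val; apply: eq_bigl => k; rewrite inE.
rewrite (eq_bigl (fun s : {set 'I_N} * 'I_i.+1 =>
    (s.1 \in [set S : {set 'I_N} | #|S| == i.+2]) && true));
  last by move=> s; rewrite !inE andbT.
rewrite -(pair_big (fun S => S \in [set S : {set 'I_N} | #|S| == i.+2]) predT
  (fun _ (b : 'I_i.+1) => G b)) /=.
rewrite sum_nat_const card_draws card_ord.
rewrite big_distrr; apply: eq_bigr => j _ /=.
by rewrite count_nseq /G mulnC; case: (a _).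
Qed.

(** * The complex as a minimal resolution of the ideal of minors *)

Section EagonNorthcottResolution.
Variables (K : closedFieldType) (n d : nat).
Local Notation pol := {mpoly K[n.+1]}.
Variable g : 'I_n.+1 -> pol.
Hypothesis uncountableK : forall u : nat -> K, exists z, forall k, u k <> z.
Hypothesis d_ge2 : (2 <= d)%N.
Hypothesis g_homogen : forall i, homogen (d - 1)%N%:Z (g i).
Local Notation X := (fun i : 'I_n.+1 => 'X_i : pol).

Definition minor_ideal (p : pol) : Prop := exists c : 'I_n.+1 -> 'I_n.+1 -> pol,
  p = \sum_(i < n.+1) \sum_(j < n.+1 | (i < j)%N) c i j * en_minor X g i j.

Hypothesis finite_zeros : exists s : seq ('I_n.+1 -> K), forall x,
  (exists i, x i != 0) -> (forall p, minor_ideal p -> p.@[x] = 0) ->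
  exists y c, List.In y s /\ forall i, x i = c * y i.

Lemma minor_ideal_ideal : is_ideal minor_ideal.
Proof.
split.
- by exists (fun _ _ => 0); rewrite big1 // => i _; rewrite big1 // => j _; rewrite mul0r.
- move=> p q [u ->] [v ->]; exists (fun i j => u i j + v i j).
  rewrite -big_split; apply: eq_bigr => i _; rewrite -big_split; apply: eq_bigr => j _.
  by rewrite mulrDl.
- move=> p q [u ->]; exists (fun i j => p * u i j).
  rewrite mulr_sumr; apply: eq_bigr => i _; rewrite mulr_sumr; apply: eq_bigr => j _.
  by rewrite mulrA.
Qed.

Lemma en_minor_homogen i j : homogen d%:Z (en_minor X g i j).
Proof.
have -> : d%:Z = 1 + (d - 1)%N%:Z by lia.
by apply: homogenD; [|apply: homogenN]; apply: homogenM => //; apply: homogenX.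
Qed.

Lemma minor_ideal_hproj P p : minor_ideal p -> minor_ideal (hproj P p).
Proof.
case=> c ->; exists (fun i j => hproj (fun e => P (e + d%:Z)) (c i j)).
rewrite hproj_sum; apply: eq_bigr => i _; rewrite hproj_sum; apply: eq_bigr => j _.
by rewrite mulrC (hprojM _ _ (@en_minor_homogen i j)) mulrC.
Qed.

Lemma minor_ideal_image p :
  minor_ideal p <-> exists v, \row_(k < 1) p = v *m en_mx X g 0.
Proof.
split=> [[c ->]|[v /rowP/(_ 0)]]; last first.
  rewrite mul_en_mx0 !mxE en_aug_minors => ->.
  by exists (fun i j => contract j (contract i (chain_of v 0%N)) set0).
pose im (q : pol) := exists v, \row_(k < 1) q = v *m en_mx X g 0.
have im0 : im 0 by exists 0; rewrite mul0mx; apply/rowP => k; rewrite !mxE.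
have imD q r : im q -> im r -> im (q + r).
  move=> [u hu] [v hv]; exists (u + v); rewrite mulmxDl -hu -hv.
  by apply/rowP => k; rewrite !mxE.
apply: (big_ind im im0 imD) => i _; apply: (big_ind im im0 imD) => j _.
have [v hv] := en_minor_mem_image X g i j.
by exists (c i j *: v); rewrite -scalemxAl hv; apply/rowP => k; rewrite !mxE.
Qed.

Lemma minor_ideal_null i (J : pol -> Prop) p (v : 'rV[pol]_(en_rank n.+1 i.+1)) :
  minor_ideal p -> is_ideal J -> row_in J (v *m en_mx X g i) ->
  exists w, row_in J (p *: v - w *m en_mx X g i.+1).
Proof.
move=> [c ->] idJ Jv.
pose nul (q : pol) := exists w, row_in J (q *: v - w *m en_mx X g i.+1).
have nul0 : nul 0 by exists 0; rewrite mul0mx scale0r subr0; apply: row_in0.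
have nulD a b : nul a -> nul b -> nul (a + b).
  move=> [u hu] [w hw]; exists (u + w).
  by have := row_inD idJ hu hw; rewrite mulmxDl opprD addrACA -scalerDl.
apply: (big_ind nul nul0 nulD) => a _; apply: (big_ind nul nul0 nulD) => b _.
have [w hw] := en_null_homotopic a b idJ Jv.
by exists (c a b *: w); have := row_inZ idJ (c a b) hw;
  rewrite scalerBr scalerA -scalemxAl.
Qed.

(** Forced by three facts: the minors have degree d, contraction by x costs 1 and keeps b,
    contraction by g costs d-1 and lowers b by 1. The index j of the expected shifts is b+1. *)
Definition en_deg i : 'I_(en_rank n.+1 i) -> int :=
  if i is i'.+1 then
    fun k : 'I_#|en_basis n.+1 i'| =>
      Posz ((en_label k).2.+1 * (d - 2) + i'.+1 + 1)%N
  else fun=> 0.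

Lemma en_mx_homogen i : homogen_mx (@en_deg i.+1) (@en_deg i) (en_mx X g i).
Proof.
have hterm e e' (f : pol) c (b : bool) : homogen e f -> (b -> e = e') ->
    homogen e' (f * (-1) ^+ c * b%:R).
  case: b => [hf /(_ isT) <-|_ _]; last by rewrite mulr0; apply: homogen0.
  by rewrite mulr1 -signr_odd; case: (odd c); rewrite ?expr0 ?expr1 ?mulrN1 ?mulr1 //;
    apply: homogenN.
case: i => [|i] k l.
  rewrite [en_mx _ _ _ _ _]en_mx0E /en_aug koszulE; apply: homogen_sum => i _.
  rewrite koszulE mulr_sumr; apply: homogen_sum => j _.
  rewrite chain_of_delta.
  have [c ->] := pos_sign_pm1 pol i set0.
  have [c' ->] := pos_sign_pm1 pol j (i |: set0).
  have -> : forall b : pol, g i * (-1) ^+ c * ('X_j * (-1) ^+ c' * b) =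
      (g i * 'X_j) * (-1) ^+ (c + c') * b by move=> b; rewrite exprD; ring.
  apply: hterm; first by apply: homogenM; [apply: g_homogen|apply: homogenX].
  move=> _; rewrite /en_deg.
  have -> : (en_label k).2 = 0%N :> nat by case: (en_label k).2 => [[]].
  by lia.
rewrite [en_mx _ _ _ _ _]en_mxSE /en_diff ffunE.
by apply: homogenD; rewrite koszulE; apply: homogen_sum => j _; rewrite chain_of_delta;
  have [c ->] := pos_sign_pm1 pol j (en_label l).1; apply: hterm;
  (exact: homogenX || exact: g_homogen || idtac);
  move=> /andP[_ /eqP e]; rewrite /en_deg e; lia.
Qed.

Lemma en_mx_minimal i : const_mx0 (en_mx X g i.+1) = 0.
Proof.
apply/matrixP => k l; rewrite [LHS]mxE [RHS]mxE.
apply: (en_mxS_vanish (phi := mcoeff 0%MM)) => j.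
  by apply: (@homogen_coeff0 _ _ 1) => //; apply: homogenX.
by apply: (@homogen_coeff0 _ _ (d - 1)%N%:Z) => //; lia.
Qed.

Lemma en_mx_exact_mod : exists a : 'I_n.+1 -> K, a ord0 = 1 /\
  forall i (v : 'rV[pol]_(en_rank n.+1 i.+1)),
    (exists t, v *m en_mx X g i = linear_form a *: t) ->
    exists u w, v = u *m en_mx X g i.+1 + linear_form a *: w.
Proof.
have [s sP] := finite_zeros.
have [a a0 aP] := exists_generic_hyperplane s uncountableK; exists a; split=> //.
have idJ := adjoin_ideal minor_ideal_ideal (linear_form a).
have [M JM] : exists M, forall i : 'I_n.+1, adjoin minor_ideal (linear_form a) ('X_i ^+ M).
  have [||Ms MsP] := fin_all_exists (graded_nullstellensatz uncountableK idJ _ _).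
  - move=> k p [u hu]; exists (hproj (fun e => e + 1 == k) u).
    have := minor_ideal_hproj (pred1 k) hu.
    rewrite hprojD [u * _]mulrC -mulrN (hprojM _ _ (@linear_form_homogen K n a)) mulrC.
    rewrite (_ : hproj _ (- u) = - hproj (fun e => e + 1 == k) u) ?mulNr //.
    by apply/mpolyP => m; rewrite mcoeffN !mcoeff_hproj mcoeffN /=; case: ifP; rewrite ?oppr0.
  (* A nonzero common zero of I and l would be a multiple of some y in s with l(y) = 0, and
     genericity of l makes that y zero. *)
  - move=> x xJ i; apply/eqP; apply: contraT => xi.
    have [||y [c [ys xy]]] := sP x; first by exists i.
      by move=> p Ip; apply: xJ; apply: adjoin_sub.
    have c0 : c != 0 by apply: contraNneq xi => c0; rewrite xy c0 mul0r.
    have /(aP y ys) y0 : \sum_i a i * y i = 0.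
      have : (linear_form a).@[x] = 0.
        by apply: xJ; apply: adjoin_self minor_ideal_ideal _.
      rewrite /linear_form raddf_sum /= => e; apply: (mulfI c0); rewrite mulr0 -[RHS]e.
      rewrite mulr_sumr; apply: eq_bigr => j _.
      by rewrite mevalZ mevalXU xy mulrCA.
    by rewrite xy y0 mulr0 eqxx in xi.
  exists (\sum_i Ms i)%N => i; rewrite (bigD1 i) //= exprD.
  by apply: idealMr.
move=> i v [t vt].
have [|||||||u hu] := @acyclic_mod_regular _ (en_rank n.+1) (en_mx X g) n
    (section_ideal M a) (fun j => 'X_(inord j.+1) ^+ M) _ _ _ _ _ _ i v.
- by move=> j w; apply: mul_en_mx_en_mx.
(* There is no subset of size j+2 in a set of n+1 elements when j >= n. *)
- move=> j nj /=; apply: eq_card0 => -[S b]; rewrite !inE /=; apply/eqP => Sj.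
  have := max_card (mem S); rewrite Sj card_ord; lia.
- exact: section_ideal_ideal.
- by [].
- by move=> j p; apply: section_ideal_regular.
- move=> j jn; have [u hu] := JM (inord j.+1).
  (* This element lies in I by the choice of u and differs from the power by a multiple of l. *)
  exists ('X_(inord j.+1) ^+ M - u * linear_form a).
    by exists (- u); rewrite addrC addKr mulrN mulrC.
  move=> k w; apply: minor_ideal_null => //; exact: section_ideal_ideal.
- by move=> k; rewrite vt mxE; exists (t 0 k).
have /fin_all_exists[w wP] k : exists q, (v - u *m en_mx X g i.+1) 0 k = linear_form a * q.
  exact: hu.
exists u, (\row_k w k); apply/rowP => k; have := wP k; rewrite !mxE => <-.
by rewrite addrC subrK.
Qed.

Lemma en_mx_exact i (v : 'rV[pol]_(en_rank n.+1 i.+1)) :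
  v *m en_mx X g i = 0 <-> exists w, v = w *m en_mx X g i.+1.
Proof.
split=> [|[w ->]]; last exact: mul_en_mx_en_mx.
have [a [a0 aP]] := en_mx_exact_mod.
apply: (graded_nakayama (@en_mx_homogen i) (@en_mx_homogen i.+1)
  (@linear_form_homogen K n a) (linear_form_neq0 a0)).
  by move=> u; apply: mul_en_mx_en_mx.
by move=> u u0; apply: aP; exists 0; rewrite u0 scaler0.
Qed.

(** l^k is a combination of monomials of degree k, so l^k p lies in I, and l cancels modulo I: if l
    q = v d_0, exactness modulo l gives v = u d_1 + l w, whence q = w d_0. *)
Lemma minor_ideal_saturated (p : pol) k :
  (forall m : 'X_{1..n.+1}, mdeg m = k -> minor_ideal ('X_[m] * p)) -> minor_ideal p.
Proof.
move=> hp; have [a [a0 aP]] := en_mx_exact_mod; set l := linear_form a in aP.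
have l0 : l != 0 by apply: linear_form_neq0.
have cancel_l q : minor_ideal (l * q) -> minor_ideal q.
  case/minor_ideal_image => v vE.
  have [|u [w vuw]] := aP 0%N v.
    by exists (\row_(k < 1) q); rewrite -vE; apply/rowP => j; rewrite !mxE.
  apply/minor_ideal_image; exists w.
  have : l *: (w *m en_mx X g 0) = \row_(k < 1) (l * q).
    rewrite vE vuw mulmxDl mul_en_mx_en_mx add0r scalemxAl //.
  move=> /rowP h; apply/rowP => j; have := h j; rewrite !mxE.
  by move/(mulfI l0).
have : minor_ideal (l ^+ k * p).
  have hl : homogen k%:Z (l ^+ k).
    elim: (k) => [|k' IHk]; first by rewrite expr0 -mpolyC1 => m; rewrite mcoeffC;
      case: (m =P 0%MM) => [->|_]; rewrite ?mdeg0 ?mulr0 ?eqxx.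
    have -> : k'.+1%:Z = 1 + k'%:Z by lia.
    by rewrite exprS; apply: homogenM => //; apply: linear_form_homogen.
  rewrite [l ^+ k]mpolyE mulr_suml big_seq; apply: ideal_sum => [|m].
    exact: minor_ideal_ideal.
  rewrite mcoeff_msupp => /hl [mk]; rewrite -mul_mpolyC -mulrA.
  by apply: idealMl; [exact: minor_ideal_ideal|exact: hp].
elim: (k) => [|k' IHk]; first by rewrite mul1r.
by rewrite exprS -mulrA => /cancel_l.
Qed.

Lemma en_deg_perm i :
  perm_eq [seq @en_deg i.+1 k | k <- enum 'I_(en_rank n.+1 i.+1)]
    (flatten [seq nseq 'C(n.+1, i.+2) (Posz (j * (d - 2) + i.+1 + 1)%N) | j <- iota 1 i.+1]).
Proof.
have := en_label_perm n.+1 i (fun j => Posz (j.+1 * (d - 2) + i.+1 + 1)%N).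
by rewrite [iota 1 _](iotaDl 1 0) -map_comp.
Qed.

End EagonNorthcottResolution.

(** * Specialization to the complex numbers *)

Section RealsUncountable.
Local Open Scope R_scope.

(** Cantor's argument: of each interval the outer third across the midpoint from u k is kept, so the
    closed third misses u k. *)
Fixpoint nested_interval (u : nat -> R) (k : nat) : R * R :=
  if k is S k' then
    let: (a, b) := nested_interval u k' in
    if Rle_dec (u k') ((a + b) / 2) then ((a + 2 * b) / 3, b) else (a, (2 * a + b) / 3)
  else (0, 1).

Lemma nested_interval_lt u k : (nested_interval u k).1 < (nested_interval u k).2.
Proof.
elim: k => [|k] /=; first lra.
by case: (nested_interval u k) => a b /= ab; case: Rle_dec => _ /=; lra.
Qed.

Lemma nested_intervalS u k :
  (nested_interval u k).1 <= (nested_interval u k.+1).1 /\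
  (nested_interval u k.+1).2 <= (nested_interval u k).2.
Proof.
have := nested_interval_lt u k; rewrite /=.
by case: (nested_interval u k) => a b /= ab; case: Rle_dec => _ /=; lra.
Qed.

Lemma nested_interval_mono u j k :
  (nested_interval u k).1 <= (nested_interval u (k + j)).1 /\
  (nested_interval u (k + j)).2 <= (nested_interval u k).2.
Proof.
elim: j => [|j [IH1 IH2]]; first by rewrite addn0; split; apply: Rle_refl.
have [h1 h2] := nested_intervalS u (k + j).
by rewrite addnS; split; lra.
Qed.

Lemma nested_interval_le u j k : (nested_interval u j).1 <= (nested_interval u k).2.
Proof.
have [h1 _] := nested_interval_mono u k j.
have [_ h2] := nested_interval_mono u j k.
rewrite addnC in h1.
by have := nested_interval_lt u (k + j); lra.
Qed.

Lemma real_uncountable (u : nat -> R) : exists z, forall k, u k <> z.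
Proof.
pose E r := exists k, r = (nested_interval u k).1.
have [z [ub lub]] : {z | is_lub E z}.
  apply: completeness; last by exists (fst (nested_interval u O)); exists O.
  by exists (snd (nested_interval u O)) => r [k ->]; apply: nested_interval_le.
exists z => k uz.
have h1 : (nested_interval u k.+1).1 <= z by apply: ub; exists k.+1.
have h2 : z <= (nested_interval u k.+1).2.
  by apply: lub => r [j ->]; apply: nested_interval_le.
have := nested_interval_lt u k; move: h1 h2; rewrite /=.
by case: (nested_interval u k) => a b /=; case: Rle_dec => /= h; lra.
Qed.

End RealsUncountable.

Lemma CC_uncountable (u : nat -> CC) : exists z : CC, forall k, u k <> z.
Proof.
have [z hz] := real_uncountable (fun k => complex.Re (u k)).
by exists (z +i* 0)%C => k uk; apply: (hz k); rewrite uk.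
Qed.

(** * Given resolutions as graded complexes *)

Section FromResolution.
Variables (n : nat) (g : 'I_n.+1 -> Pol n) (F : gres n).

(** R is put in front at index 0, with [phi1] as its incoming differential, to match the indexing of
    [en_rank]. *)
Definition gres_rank i := if i is i'.+1 then rk F i' else 1%N.
Definition gres_deg i : 'I_(gres_rank i) -> int :=
  if i is i'.+1 then dg F i' else fun=> 0.
Definition gres_d i : 'M[{mpoly CC[n.+1]}]_(gres_rank i.+1, gres_rank i) :=
  if i is i'.+1 then mp F i' else phi1 F.

Hypothesis resF : is_graded_free_res g F.

Lemma gres_homogen i : homogen_mx (@gres_deg i.+1) (@gres_deg i) (gres_d i).
Proof.
have [h0 [hS _]] := resF.
case: i => [|i] k l; last exact: hS.
by rewrite /= subr0 (ord1 l); apply: h0.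
Qed.

Lemma gres_exact i (v : 'rV_(gres_rank i.+1)) :
  v *m gres_d i = 0 <-> exists w, v = w *m gres_d i.+1.
Proof.
have [_ [_ [_ [h0 hS]]]] := resF.
by case: i v => [|i] v; [apply: h0|apply: hS].
Qed.

Definition complex_of_gres : graded_complex CC n.+1 :=
  GradedComplex gres_homogen gres_exact.

Lemma complex_of_gres_minimal : is_minimal_res F -> minimal_complex complex_of_gres.
Proof. by move=> minF i; apply/matrixP => k l; rewrite mxE minF mxE. Qed.

End FromResolution.

Theorem theorem2p1 (n d : nat) (g : 'I_n.+1 -> Pol n) :
  leq 1 n -> leq 2 d ->
  (forall i, homogeneous (Posz (d - 1)) (g i)) ->
  zero_dim_VI g ->
  saturated_I g /\
  (exists F : gres n, is_min_graded_free_res g F) /\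
  (forall F : gres n, is_min_graded_free_res g F -> has_expected_shape n d F).
Proof.
move=> n1 d2 hg [_ [s sP]].
have finV : exists s : seq ('I_n.+1 -> CC), forall x, (exists i, x i != 0) ->
    (forall p, minor_ideal g p -> p.@[x] = 0) ->
    exists y c, List.In y s /\ forall i, x i = c * y i.
  by exists s => x x0 xI; apply: sP; split.
have sat := minor_ideal_saturated CC_uncountable d2 hg finV.
have exactEN := en_mx_exact CC_uncountable d2 hg finV.
have homEN := en_mx_homogen d2 hg.
have minim := en_mx_minimal d2 hg.
have image := minor_ideal_image g.
split; first by move=> f [k hk]; apply: sat hk.
pose EN := GradedComplex homEN exactEN.
split.
  exists (@GRes n (fun i => #|en_basis n.+1 i|) (fun i => @en_deg n d i.+1)
    (en_mx (fun i : 'I_n.+1 => 'X_i) g 0)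
    (fun i => en_mx (fun i : 'I_n.+1 => 'X_i) g i.+1)).
  split; last first.
    by move=> i k l; have /matrixP/(_ k l) := minim i; rewrite !mxE.
  split; first by move=> k; have := homEN 0%N k 0; rewrite /= subr0.
  split; first by move=> i; apply: (homEN i.+1).
  split; last by split=> [|i]; apply: exactEN.
  move=> p; split => [/image[v vE]|[v vE]].
    by exists v; rewrite -vE mxE.
  by apply/image; exists v; apply/rowP => k; rewrite ord1 mxE vE.
move=> F [resF minF].
have perm i : perm_eq [seq dg F i k | k <- enum 'I_(rk F i)] (expected_shifts n d i.+1).
  apply: perm_trans (en_deg_perm n d i).
  have [h0 [hS [imF _]]] := resF.
  apply: (minimal_complex_deg (F := complex_of_gres resF) (G := EN) (t := 1)
    (c := fun=> 0) (A := phi1 F) (B := en_mx (fun i : 'I_n.+1 => 'X_i) g 0)).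
  - exact: complex_of_gres_minimal.
  - exact: minim.
  - exact: (@gres_homogen n g F resF 0).
  - exact: (homEN 0%N).
  - by [].
  - by [].
  move=> u; split=> [[v vE]|[w wE]].
    have /image[w wE] : in_I g (u 0 0) by apply/imF; exists v; rewrite vE.
    by exists w; rewrite -wE; apply/rowP => k; rewrite ord1 mxE.
  have /imF[v vE] : in_I g (u 0 0).
    by apply/image; exists w; rewrite -wE; apply/rowP => k; rewrite ord1 mxE.
  by exists v; apply/rowP => k; rewrite ord1.
split=> [[|i] /andP[i0 _]|[|i] ni]; [by []|exact: (perm i)|by []|].
(* Beyond n the rank equals that of the Eagon-Northcott module, which is 0 for want of subsets of
   size i+2. *)
have := perm_size (perm i); rewrite size_map size_enum_ord => ->.
have := perm_size (en_deg_perm n d i); rewrite size_map size_enum_ord => <-.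
apply: eq_card0 => -[S b]; rewrite !inE /=; apply/eqP => Sj.
have {}ni : (n < i.+1)%N := ni.
by have := max_card (mem S); rewrite Sj card_ord ltnS leqNgt ni.
Qed.
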